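(* Let $1<q<\infty$ and $\alpha,\beta\in\mathbb{R}$, and set $\rho_{\alpha,\beta}(x):=(1+|x|)^{\alpha}(1+|x|-x_1)^{\beta}$ for $x=(x_1,x_2,x_3)\in\mathbb{R}^3$. Then $\rho_{\alpha,\beta}$ belongs to the Muckenhoupt class $\mathscr{A}_q(\mathbb{R}^3)$ if and only if $$-1<\beta<q-1\quad\text{and}\quad -3<\alpha+\beta<3(q-1).$$
   Context: For $1<q<\infty$, a nonnegative function $\rho\in L^1_{\rm loc}(\mathbb{R}^3)$ belongs to the Muckenhoupt class $\mathscr{A}_q(\mathbb{R}^3)$ if there is a constant $C>0$ such that $$\left(\frac{1}{|B|}\int_{B}\rho(y)\,dy\right)\left(\frac{1}{|B|}\int_{B}\rho(y)^{-\frac{1}{q-1}}\,dy\right)^{q-1}\leq C$$ for all balls $B=B_r(x)=\{y\in\mathbb{R}^3: |y-x|<r\}$, where $|B|$ is the Lebesgue measure of $B$. *)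

(* Defs.v *)
From HB Require Import structures.
From mathcomp Require Import all_boot all_order all_algebra.
From mathcomp Require Import all_classical all_reals all_analysis.
From mathcomp Require Import measurable_realfun.

Set Implicit Arguments.
Unset Strict Implicit.
Unset Printing Implicit Defensive.
Import Order.TTheory GRing.Theory Num.Theory.
Import numFieldNormedType.Exports.

Local Open Scope classical_set_scope.
Local Open Scope ring_scope.

(* A point of R^3 is ((x1, x2), x3). The sigma-algebra (Borel) and the topology
   are the product ones. The library norm and balls on a product are those of
   the sup norm, so the Euclidean ones are defined here. *)
Notation R3 R := (R * R * R)%type.

Definition lebesgue3 (R : realType) :
    {measure set (R3 (measurableTypeR R)) -> \bar R} :=
  ((@lebesgue_measure R \x @lebesgue_measure R) \x @lebesgue_measure R)%E.

Section euclidean3.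
Context {R : realType}.

Definition enorm3 (x : R3 R) : R :=
  Num.sqrt (x.1.1 ^+ 2 + x.1.2 ^+ 2 + x.2 ^+ 2).

Definition eball3 (x : R3 R) (r : R) : set (R3 R) :=
  [set y | enorm3 (y - x) < r].

End euclidean3.

Section muckenhoupt.
Context {R : realType}.
Local Open Scope ereal_scope.

Definition locally_integrable3 (f : R3 R -> R) : Prop :=
  measurable_fun [set: R3 (measurableTypeR R)] f /\
  forall K : set (R3 R), compact K ->
    \int[lebesgue3 R]_(x in K) `|f x|%:E < +oo.

Definition average3 (B : set (R3 R)) (f : R3 R -> \bar R) : \bar R :=
  (lebesgue3 R B)^-1 * \int[lebesgue3 R]_(y in B) f y.

(* a ^ (- s) for a >= 0 and s > 0, with value +oo at a = 0
   (whereas the library has 0 `^ (- s) = 0). *)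
Definition negpow (a s : R) : \bar R := ((a `^ s)%R%:E)^-1.

Definition muckenhoupt (q : R) (rho : R3 R -> R) : Prop :=
  [/\ forall x, (0 <= rho x)%R,
      locally_integrable3 rho &
      exists2 C : R, (0 < C)%R &
        forall (x : R3 R) (r : R), (0 < r)%R ->
          average3 (eball3 x r) (fun y => (rho y)%:E) *
          average3 (eball3 x r) (fun y => negpow (rho y) (q - 1)^-1%R)
            `^ (q - 1) <= C%:E].

End muckenhoupt.

Definition aniso_weight {R : realType} (alpha beta : R) (x : R3 R) : R :=
  (1 + enorm3 x) `^ alpha * (1 + enorm3 x - x.1.1) `^ beta.

(* Main.v *)
Require Import Defs.
From HB Require Import structures.
From mathcomp Require Import all_boot all_order all_algebra.
From mathcomp Require Import all_classical all_reals all_analysis.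
From mathcomp Require Import measurable_realfun.
From mathcomp Require Import ring lra.

(* Write s(y) = 1 + |y| - y_1, so that s(y) (1 + |y| + y_1) = 1 + 2|y| + y_2^2 + y_3^2.
   The dual weight of rho_{a,b} is rho_{-a/(q-1),-b/(q-1)}, and the condition on
   (a, b) says that both pairs satisfy b > -1 and a + b > -3.

   Sufficiency: if b > -1 and a + b > -3, then the average of rho_{a,b} over
   B_r(x) is at most C D^a F^b with D = 1 + |x| + r and F = s(x) + r^2 / D. These
   bounds cancel for a weight and its dual. To prove the bound, dominate rho_{a,b}
   on the ball by a multiple of a product of powers (1 + |y_i|)^(g_i) with
   -1 < g_i <= 0, whose average over any ball of radius r is O(r^(g_1+g_2+g_3)).

   Necessity: if b <= -1 or a + b <= -3, a large ball centred at the origin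
   contains N disjoint boxes at dyadic scales carrying comparable amounts of
   rho_{a,b}; the averages of rho_{a,b} are then N times what the bulk of the ball
   accounts for, whereas those of the dual weight are not smaller than the bulk
   predicts. *)

Import Order.TTheory GRing.Theory Num.Theory.
Import numFieldNormedType.Exports.
Local Open Scope classical_set_scope.
Local Open Scope ring_scope.

(** * The Euclidean norm and the weight *)

(** The anisotropic factor of the weight; its sublevel sets are solid paraboloids around the
    positive x_1-axis. *)
Definition wake {R : realType} (x : R3 R) : R := 1 + enorm3 x - x.1.1.

Section geometry.
Context {R : realType}.
Implicit Types (x y : R3 R).

Lemma enorm3_ge0 x : 0 <= enorm3 x.
Proof. exact: sqrtr_ge0. Qed.

Lemma sqr_enorm3 x : enorm3 x ^+ 2 = x.1.1 ^+ 2 + x.1.2 ^+ 2 + x.2 ^+ 2.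
Proof. by rewrite sqr_sqrtr// !addr_ge0// sqr_ge0. Qed.

Lemma enorm3_le x r : 0 <= r ->
  x.1.1 ^+ 2 + x.1.2 ^+ 2 + x.2 ^+ 2 <= r ^+ 2 -> enorm3 x <= r.
Proof.
by move=> r0 xr; rewrite -(@ler_pXn2r _ 2) ?nnegrE ?enorm3_ge0// sqr_enorm3.
Qed.

Lemma le_enorm3 x r : 0 <= r ->
  r ^+ 2 <= x.1.1 ^+ 2 + x.1.2 ^+ 2 + x.2 ^+ 2 -> r <= enorm3 x.
Proof.
by move=> r0 xr; rewrite -(@ler_pXn2r _ 2) ?nnegrE ?enorm3_ge0// sqr_enorm3.
Qed.

Lemma coord_le_enorm3 x :
  [/\ `|x.1.1| <= enorm3 x, `|x.1.2| <= enorm3 x & `|x.2| <= enorm3 x].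
Proof.
split; apply: le_enorm3 => //; rewrite real_normK ?num_real//;
  have := sqr_ge0 x.1.1; have := sqr_ge0 x.1.2; have := sqr_ge0 x.2; lra.
Qed.

Lemma enorm3N x : enorm3 (- x) = enorm3 x.
Proof. by rewrite /enorm3 /= !sqrrN. Qed.

Lemma enorm3_distC x y : enorm3 (x - y) = enorm3 (y - x).
Proof. by rewrite -enorm3N opprB. Qed.

Lemma ler_enorm3D x y : enorm3 (x + y) <= enorm3 x + enorm3 y.
Proof.
have x0 := enorm3_ge0 x; have y0 := enorm3_ge0 y.
apply: enorm3_le; first exact: addr_ge0.
suff : x.1.1 * y.1.1 + x.1.2 * y.1.2 + x.2 * y.2 <= enorm3 x * enorm3 y.
  by rewrite (sqrrD (enorm3 x)) !sqr_enorm3 /=; lra.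
apply: le_trans (ler_norm _) _.
rewrite -(@ler_pXn2r _ 2) ?nnegrE ?mulr_ge0// real_normK ?num_real//.
rewrite exprMn !sqr_enorm3.
(* Lagrange's identity: the three squares add up to the defect in the Cauchy-Schwarz inequality. *)
have := sqr_ge0 (x.1.1 * y.1.2 - x.1.2 * y.1.1).
have := sqr_ge0 (x.1.1 * y.2 - x.2 * y.1.1).
have := sqr_ge0 (x.1.2 * y.2 - x.2 * y.1.2).
by lra.
Qed.

Lemma ler_enorm3B x y : enorm3 y <= enorm3 x + enorm3 (y - x).
Proof. by rewrite -{1}(subrKC x y) ler_enorm3D. Qed.

Lemma wake_ge1 x : 1 <= wake x.
Proof.
rewrite /wake; have [+ _ _] := coord_le_enorm3 x.
by move=> /(le_trans (ler_norm _)); lra.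
Qed.

Lemma wake_le x : wake x <= 1 + 2 * enorm3 x.
Proof.
rewrite /wake; have [+ _ _] := coord_le_enorm3 x.
by rewrite ler_norml => /andP[]; lra.
Qed.

Lemma wake_distl x y : wake y <= wake x + 2 * enorm3 (y - x).
Proof.
have h := ler_enorm3B x y; have [+ _ _] := coord_le_enorm3 (y - x).
by rewrite ler_norml /wake /= => /andP[]; lra.
Qed.

(** The difference of squares (1 + |x|)^2 - x_1^2, with |x|^2 expanded. *)
Lemma wakeM x : wake x * (1 + enorm3 x + x.1.1)
  = 1 + 2 * enorm3 x + x.1.2 ^+ 2 + x.2 ^+ 2.
Proof. by have := sqr_enorm3 x; rewrite /wake; lra. Qed.

(** Follows from [wakeM], as 1 + |x| + x_1 <= 2 (1 + |x|). It turns a negative power of [wake] into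
    powers of the two transverse coordinates, at the cost of a power of 1 + |x|. *)
Lemma wake_transverse x :
  (1 + `|x.1.2|) * (1 + `|x.2|) <= 2 * (wake x * (1 + enorm3 x)).
Proof.
have [x1 x2 x3] := coord_le_enorm3 x; have := wakeM x; have w1 := wake_ge1 x.
have : wake x * (1 + enorm3 x + x.1.1) <= wake x * (2 * (1 + enorm3 x)).
  apply: ler_wpM2l; first lra.
  by have := enorm3_ge0 x; move: x1; rewrite ler_norml => /andP[]; lra.
rewrite -(real_normK (num_real x.1.2)) -(real_normK (num_real x.2)).
have := sqr_ge0 (`|x.1.2| - `|x.2|); have := enorm3_ge0 x.
nra.
Qed.

(* With n = |x| and h = y - x: n|y| <= (n^2 + |y|^2)/2 = n^2 + x.h + |h|^2/2, and
   (x - n e1).h <= |x - n e1|^2/2 + |h|^2/2, where |x - n e1|^2 = 2n(n - x1). *)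
Lemma wake_quasi_lip x y :
  enorm3 x * wake y <= 2 * (enorm3 x * wake x) + enorm3 (y - x) ^+ 2.
Proof.
have hx := sqr_enorm3 x; have hy := sqr_enorm3 y; have hh := sqr_enorm3 (y - x).
move: hh => /= hh; rewrite hh {hh} /wake.
have := sqr_ge0 (enorm3 x - enorm3 y); have := enorm3_ge0 x.
have := sqr_ge0 (x.1.1 - enorm3 x - (y.1.1 - x.1.1)).
have := sqr_ge0 (x.1.2 - (y.1.2 - x.1.2)).
have := sqr_ge0 (x.2 - (y.2 - x.2)).
move: hx hy; lra.
Qed.

End geometry.

(** * Powers with real exponents *)

Section powers.
Context {R : realType}.

Lemma powR_le_nonneg (a b g : R) : 0 <= a -> a <= b -> 0 <= g -> a `^ g <= b `^ g.
Proof.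
by move=> a0 ab g0; apply: ge0_ler_powR => //; rewrite nnegrE// (le_trans a0).
Qed.

(** Comparability is two-sided because the sign of [g] is free: one bound serves g >= 0, the other g
    < 0. *)
Lemma powR_comparable (K u A g : R) : 0 < K -> 0 < u -> 0 < A ->
  u <= K * A -> A <= K * u -> u `^ g <= K `^ `|g| * A `^ g.
Proof.
move=> K0 u0 A0 uA Au; have [g0|g0] := leP 0 g.
  by rewrite ger0_norm// -powRM ?(ltW K0, ltW A0)// powR_le_nonneg// ltW.
rewrite ltr0_norm// -{1 3}(opprK g) 2!(powRN _ (- g)).
rewrite -[leLHS]div1r ler_pdivrMr ?powR_gt0// mulrAC ler_pdivlMr ?powR_gt0//.
by rewrite mul1r -powRM ?(ltW K0, ltW u0)// powR_le_nonneg ?oppr_ge0 ?(ltW g0) ?(ltW A0).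
Qed.

Lemma powR_le_nonpos (a b g : R) : 0 < a -> a <= b -> g <= 0 -> b `^ g <= a `^ g.
Proof.
move=> a0 ab g0; rewrite -(opprK g) 2!(powRN _ (- g)).
rewrite lef_pV2 ?posrE ?powR_gt0//; last exact: (lt_le_trans a0 ab).
by apply: powR_le_nonneg; rewrite ?oppr_ge0 ?(ltW a0).
Qed.

Lemma powRDn (a x y : R) : 0 < a -> a `^ (x + y) = a `^ x * a `^ y.
Proof. by move=> a0; rewrite powRD// (gt_eqF a0) implybT. Qed.

End powers.

(** * Powers and comparability of the weight *)

Section weight.
Context {R : realType}.
Implicit Types (x y : R3 R) (a b : R).

Lemma aniso_weight_wakeE a b x :
  aniso_weight a b x = (1 + enorm3 x) `^ a * wake x `^ b.
Proof. by []. Qed.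

Lemma aniso_weight_gt0 a b x : 0 < aniso_weight a b x.
Proof.
by rewrite mulr_gt0// powR_gt0; have := enorm3_ge0 x; have := wake_ge1 x;
  rewrite /wake; lra.
Qed.

Lemma aniso_weight_pow a b t x :
  aniso_weight a b x `^ t = aniso_weight (a * t) (b * t) x.
Proof.
by rewrite /aniso_weight powRM ?powR_ge0// -!powRrM.
Qed.

Lemma aniso_weight_le K A S a b x : 0 < K -> 0 < A -> 0 < S ->
  1 + enorm3 x <= K * A -> A <= K * (1 + enorm3 x) ->
  wake x <= K * S -> S <= K * wake x ->
  aniso_weight a b x <= K `^ (`|a| + `|b|) * (A `^ a * S `^ b).
Proof.
move=> K0 A0 S0 *; have e0 := enorm3_ge0 x; have w1 := wake_ge1 x.
rewrite powRDn// mulrACA aniso_weight_wakeE.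
apply: ler_pM; rewrite ?powR_ge0//; apply: powR_comparable => //; lra.
Qed.

Lemma aniso_weight_ge K A S a b x : 0 < K -> 0 < A -> 0 < S ->
  1 + enorm3 x <= K * A -> A <= K * (1 + enorm3 x) ->
  wake x <= K * S -> S <= K * wake x ->
  A `^ a * S `^ b <= K `^ (`|a| + `|b|) * aniso_weight a b x.
Proof.
move=> K0 A0 S0 *; have e0 := enorm3_ge0 x; have w1 := wake_ge1 x.
rewrite powRDn// aniso_weight_wakeE mulrACA.
apply: ler_pM; rewrite ?powR_ge0//; apply: powR_comparable => //; lra.
Qed.

End weight.

(** * Pointwise domination on balls *)

Section upper_bound.
Context {R : realType}.
Implicit Types (x y : R3 R) (a b c k r C : R).

(** With [ball_wake], the D and F of the overview: the typical sizes of 1 + |y| and of [wake] on the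
    ball. Near the positive axis, a transverse displacement r at distance D from the origin raises
    [wake] by about r^2 / D. *)
Definition ball_size x r : R := 1 + enorm3 x + r.

Definition ball_wake x r : R := wake x + r ^+ 2 / ball_size x r.

Definition ball_weight a b x r : R := ball_size x r `^ a * ball_wake x r `^ b.

(** K r^(g1 + g2 + g3) stands for the average of the dominating product over the ball. The exponents
    may vary with the ball; a lower bound [c] common to all balls makes the later integration
    uniform. *)
Definition dominated a b c C x r := exists K g1 g2 g3 : R,
  [/\ 0 <= K, c <= g1 <= 0, c <= g2 <= 0, c <= g3 <= 0 &
   K * r `^ (g1 + g2 + g3) <= C * ball_weight a b x r /\
   forall y, enorm3 (y - x) < r -> aniso_weight a b y <=
     K * ((1 + `|y.1.1|) `^ g1 * (1 + `|y.1.2|) `^ g2 * (1 + `|y.2|) `^ g3)].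

Lemma ball_size_ge1 x r : 0 < r -> 1 <= ball_size x r.
Proof. by rewrite /ball_size; have := enorm3_ge0 x; lra. Qed.

Lemma ball_wake_ge1 x r : 0 < r -> 1 <= ball_wake x r.
Proof.
move=> r0; have D1 := ball_size_ge1 x r r0; have w1 := wake_ge1 x.
by rewrite (le_trans w1)// lerDl divr_ge0// ?sqr_ge0//; lra.
Qed.

Lemma ball_weight_gt0 a b x r : 0 < r -> 0 < ball_weight a b x r.
Proof.
by move=> r0; have := ball_size_ge1 x r r0; have := ball_wake_ge1 x r r0;
  move=> *; rewrite mulr_gt0// powR_gt0; lra.
Qed.

Lemma enorm3_ball x y r : enorm3 (y - x) < r ->
  enorm3 y < enorm3 x + r /\ enorm3 x < enorm3 y + r.
Proof.
move=> yr; have := ler_enorm3B x y; have := ler_enorm3B y x.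
by rewrite enorm3_distC; lra.
Qed.

Lemma dominatedW a b c C C' x r : 0 < r -> C <= C' ->
  dominated a b c C x r -> dominated a b c C' x r.
Proof.
move=> r0 CC' [K [g1 [g2 [g3 [K0 h1 h2 h3 [h4 h5]]]]]].
exists K, g1, g2, g3; split => //; split => //; apply: le_trans h4 _.
by rewrite ler_wpM2r// ltW// ball_weight_gt0.
Qed.

Lemma dominated_comparable a b c k x r : 0 < r -> c <= 0 -> 0 < k ->
  (forall y, enorm3 (y - x) < r ->
    [/\ 1 + enorm3 y <= k * ball_size x r, ball_size x r <= k * (1 + enorm3 y),
        wake y <= k * ball_wake x r & ball_wake x r <= k * wake y]) ->
  dominated a b c (k `^ (`|a| + `|b|)) x r.
Proof.
move=> r0 c0 k0 h; exists (k `^ (`|a| + `|b|) * ball_weight a b x r), 0, 0, 0.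
rewrite c0 lexx; split => //.
  by rewrite mulr_ge0 ?powR_ge0// ltW// ball_weight_gt0.
split=> [|y /h[h1 h2 h3 h4]]; first by rewrite !addr0 powRr0 mulr1.
rewrite !powRr0 !mulr1; apply: aniso_weight_le => //.
- by have := ball_size_ge1 x r r0; lra.
- by have := ball_wake_ge1 x r r0; lra.
Qed.

Lemma wake_powR_le b y : b <= 0 -> wake y `^ b <=
  2 `^ (- b) * (1 + enorm3 y) `^ (- b) *
    ((1 + `|y.1.2|) `^ b * (1 + `|y.2|) `^ b).
Proof.
move=> b0; have h := wake_transverse y; have w1 := wake_ge1 y.
have e0 := enorm3_ge0 y.
have y2 : 0 < 1 + `|y.1.2| by rewrite ltr_pwDl.
have y3 : 0 < 1 + `|y.2| by rewrite ltr_pwDl.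
rewrite -!powRM ?(ltW y2) ?(ltW y3)//; last lra.
rewrite (powRN _ b) mulrC ler_pdivlMr; last by rewrite powR_gt0; lra.
rewrite -powRM; [|lra|lra].
by apply: powR_le_nonpos => //; lra.
Qed.

(** For r <= 1 both factors, which are at least 1, vary by at most 2 from the centre, so they are
    comparable to constants. *)
Lemma dominated_small a b c x r : 0 < r <= 1 -> c <= 0 ->
  dominated a b c (4 `^ (`|a| + `|b|)) x r.
Proof.
move=> /andP[r0 r1] c0; apply: dominated_comparable => // y yr.
have [yx xy] := enorm3_ball _ _ _ yr.
have h1 := wake_distl x y; have h2 := wake_distl y x.
rewrite enorm3_distC in h2.
have D1 := ball_size_ge1 x r r0; have w1 := wake_ge1 x; have w1' := wake_ge1 y.
have q0 : 0 <= r ^+ 2 / ball_size x r by rewrite divr_ge0 ?sqr_ge0//; lra.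
have q1 : r ^+ 2 / ball_size x r <= 1.
  rewrite ler_pdivrMr; last lra.
  by rewrite mul1r (le_trans _ D1)// exprn_ile1// ltW.
have e0 := enorm3_ge0 x; have e0' := enorm3_ge0 y.
by split; rewrite /ball_wake ?/ball_size; rewrite ?/ball_size in q0 q1 *; lra.
Qed.

(* When the ball is large compared with |x|, both factors of the weight are
   comparable to [r] on most of it, and the weight is bounded by a product of
   powers of the coordinates whose exponents exceed [-1]. *)
Lemma dominated_center a b c x r :
  let b0 := Num.min b 0 in let e := Num.min (a + b - 2 * b0) 0 in
  -1 < b -> -3 < a + b -> 1 <= r -> enorm3 x <= 2 * r ->
  c <= e / (3 + 2 * b0) -> c <= e * (1 + b0) / (3 + 2 * b0) + b0 ->
  dominated a b c
    (2 `^ (b - 2 * b0) * 4 `^ `|e + 2 * b0| * 16 `^ `|b|) x r.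
Proof.
move=> b0 e b1 ab3 r1 xr c1 c2.
have e0 : e <= 0 by rewrite /e ge_min lexx orbT.
have b00 : b0 <= 0 by rewrite /b0 ge_min lexx orbT.
have b0b : b0 <= b by rewrite /b0 ge_min lexx.
have b01 : -1 < b0 by rewrite /b0 lt_min b1; lra.
have ea : e <= a + b - 2 * b0 by rewrite /e ge_min lexx.
move: (e) (b0) e0 b00 b0b b01 ea c1 c2 => {b0 e} e b0 e0 b00 b0b b01 ea c1 c2.
(* The exponent [e] is shared among the coordinates in proportion to the room left above -1: 1 for
   y_1, and 1 + b0 for each of y_2, y_3, which already carry [b0]. *)
set e1 := e / _ in c1 *; set e2 := e * _ / _ in c2 *.
have d0 : 0 < 3 + 2 * b0 by lra.
have e1e2 : e1 + (e2 + e2) = e by rewrite /e1 /e2; field; lra.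
have e10 : e1 <= 0 by rewrite /e1 ler_pdivrMr//; lra.
have e20 : e2 <= 0 by rewrite /e2 ler_pdivrMr// mul0r mulr_le0_ge0//; lra.
have r0 : 0 < r by lra.
have D1 := ball_size_ge1 x r r0; have W1 := ball_wake_ge1 x r r0.
have ex := enorm3_ge0 x.
(* The net exponent of 1 + |y| is a + b - 2 b0. Its part [e] goes to the coordinates; the remainder
   is nonnegative and is bounded through [ball_size]. *)
exists (2 `^ (b - 2 * b0) * ball_size x r `^ (a + b - 2 * b0 - e)),
  e1, (e2 + b0), (e2 + b0); split.
- by rewrite mulr_ge0 ?powR_ge0.
- by rewrite c1.
- by rewrite c2; lra.
- by rewrite c2; lra.
split.
  rewrite -!mulrA ler_pM2l ?powR_gt0//.
  have -> : e1 + (e2 + b0) + (e2 + b0) = e + 2 * b0 by lra.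
  apply: (@le_trans _ _ (ball_size x r `^ (a + b - 2 * b0 - e) *
      (4 `^ `|e + 2 * b0| * ball_size x r `^ (e + 2 * b0)))).
    rewrite ler_pM2l; last by rewrite powR_gt0; lra.
    by apply: powR_comparable => //; rewrite /ball_size; lra.
  rewrite mulrCA ler_pM2l ?powR_gt0// -powRDn; last lra.
  have -> : a + b - 2 * b0 - e + (e + 2 * b0) = a + b by lra.
  rewrite powRDn; last lra.
  rewrite /ball_weight mulrCA ler_pM2l; last by rewrite powR_gt0; lra.
  have q0 : 0 <= r ^+ 2 / ball_size x r by rewrite divr_ge0 ?sqr_ge0//; lra.
  have q1 : r ^+ 2 / ball_size x r <= r.
    rewrite ler_pdivrMr; last lra.
    by rewrite expr2 ler_pM2l// /ball_size; lra.
  have q2 : r / 4 <= r ^+ 2 / ball_size x r.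
    rewrite ler_pdivlMr; last lra.
    by rewrite expr2 -mulrA ler_pM2l// /ball_size; lra.
  (* Here r <= D <= 4 r, so r^2 / D >= r / 4 >= D / 16; this is the origin of the constant 16. *)
  apply: powR_comparable; rewrite ?/ball_wake; [lra|lra|..].
  - by have := wake_ge1 x; lra.
  - by have := wake_ge1 x; rewrite /ball_size in q0 q1 q2 *; lra.
  - by have := wake_le x; rewrite /ball_size in q0 q1 q2 *; lra.
move=> y yr; have [yx xy] := enorm3_ball _ _ _ yr.
have ey := enorm3_ge0 y; have wy := wake_ge1 y.
have y1 : 0 < 1 + `|y.1.1| by rewrite ltr_pwDl.
have y2 : 0 < 1 + `|y.1.2| by rewrite ltr_pwDl.
have y3 : 0 < 1 + `|y.2| by rewrite ltr_pwDl.
have [z1 z2 z3] := coord_le_enorm3 y.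
have n0 : 0 < 1 + enorm3 y by lra.
rewrite aniso_weight_wakeE.
(* The nonnegative power b - b0 is bounded by [wake_le], the nonpositive power [b0] by
   [wake_transverse]. *)
have -> : wake y `^ b = wake y `^ (b - b0) * wake y `^ b0.
  by rewrite -powRDn; [congr powR; lra|lra].
have h1 : wake y `^ (b - b0) <= (2 * (1 + enorm3 y)) `^ (b - b0).
  by apply: powR_le_nonneg; have := wake_le y; lra.
apply: (@le_trans _ _ ((1 + enorm3 y) `^ a *
  ((2 * (1 + enorm3 y)) `^ (b - b0) *
  (2 `^ (- b0) * (1 + enorm3 y) `^ (- b0) *
    ((1 + `|y.1.2|) `^ b0 * (1 + `|y.2|) `^ b0))))).
  rewrite ler_pM2l ?powR_gt0//; apply: ler_pM; rewrite ?powR_ge0//.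
  exact: wake_powR_le.
have -> : (1 + enorm3 y) `^ a * ((2 * (1 + enorm3 y)) `^ (b - b0) *
    (2 `^ (- b0) * (1 + enorm3 y) `^ (- b0) *
    ((1 + `|y.1.2|) `^ b0 * (1 + `|y.2|) `^ b0))) =
  2 `^ (b - 2 * b0) * ((1 + enorm3 y) `^ (a + b - 2 * b0 - e) *
   ((1 + enorm3 y) `^ e1 * (1 + enorm3 y) `^ e2 * (1 + enorm3 y) `^ e2)) *
    ((1 + `|y.1.2|) `^ b0 * (1 + `|y.2|) `^ b0).
  rewrite powRM//; last lra.
  have -> : b - 2 * b0 = (b - b0) + (- b0) by lra.
  have -> : a + b - 2 * b0 - e = (a + (b - b0) + (- b0)) + (- (e1 + (e2 + e2))) by lra.
  rewrite (powRDn _ (b - b0) (- b0))// !(powRDn (1 + enorm3 y))//.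
  rewrite (powRN _ (_ + _)) !(powRDn (1 + enorm3 y))//.
  by field; rewrite !gt_eqF ?powR_gt0.
rewrite -!mulrA ler_pM2l ?powR_gt0//.
rewrite !(powRDn _ e2)//.
rewrite [leRHS](_ : _ = ball_size x r `^ (a + b - 2 * b0 - e) *
  ((1 + `|y.1.1|) `^ e1 * ((1 + `|y.1.2|) `^ e2 * ((1 + `|y.2|) `^ e2 *
  ((1 + `|y.1.2|) `^ b0 * (1 + `|y.2|) `^ b0))))); last by ring.
have hm g u : g <= 0 -> u <= enorm3 y -> 0 < 1 + u ->
  (1 + enorm3 y) `^ g <= (1 + u) `^ g.
  by move=> g0 uy u0; apply: powR_le_nonpos => //; lra.
repeat (apply: ler_pM; rewrite ?mulr_ge0 ?powR_ge0 ?hm//).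
by apply: powR_le_nonneg; rewrite /ball_size; lra.
Qed.

(* Far from the origin and close to the positive [x_1]-axis, [1 + |y|] is
   essentially constant while the other factor behaves like
   [(1 + |y_2|^2 + |y_3|^2) / |x|]. *)
Lemma dominated_far a b c x r : let b0 := Num.min b 0 in
  c <= b0 -> 1 <= r -> 2 * r < enorm3 x ->
  dominated a b c (5 `^ (`|a| + `|b|) +
    4 `^ `|a - b0| * 2 `^ (b - 2 * b0) * 10 `^ (- b0)) x r.
Proof.
move=> b0 cb0 r1 xr.
have b00 : b0 <= 0 by rewrite /b0 ge_min lexx orbT.
have b0b : b0 <= b by rewrite /b0 ge_min lexx.
move: (b0) b00 b0b cb0 => {b0} b0 b00 b0b cb0.
have r0 : 0 < r by lra.
have D1 := ball_size_ge1 x r r0; have W1 := ball_wake_ge1 x r r0.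
have wx := wake_ge1 x.
have x0 : 0 < enorm3 x by lra.
have q0 : 0 <= r ^+ 2 / ball_size x r by rewrite divr_ge0 ?sqr_ge0//; lra.
have q1 : r ^+ 2 / ball_size x r <= r ^+ 2 / enorm3 x.
  apply: ler_wpM2l; first exact: sqr_ge0.
  by rewrite lef_pV2 ?posrE ?/ball_size//; lra.
have q2 : r ^+ 2 / enorm3 x <= 2 * (r ^+ 2 / ball_size x r).
  rewrite mulrCA; apply: ler_wpM2l; first exact: sqr_ge0.
  rewrite ler_pdivlMr; last by rewrite /ball_size; lra.
  by rewrite mulrC ler_pdivrMr// /ball_size; lra.
(* This is [wake_quasi_lip] divided by |x|. *)
have wU y : enorm3 (y - x) < r -> wake y <= 2 * ball_wake x r.
  move=> yr.
  suff : wake y <= 2 * wake x + r ^+ 2 / enorm3 x by rewrite /ball_wake; lra.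
  rewrite -(ler_pM2l x0) (mulrDr _ (2 * wake x)) (mulrCA _ (r ^+ 2)) divff ?gt_eqF// mulr1.
  have := wake_quasi_lip x y; have : enorm3 (y - x) ^+ 2 <= r ^+ 2.
    by apply: lerXn2r; rewrite ?nnegrE ?enorm3_ge0//; lra.
  lra.
(* In the first case the ball stays away from the axis: the quadratic error r^2 is absorbed and
   [wake] is comparable to its value at the centre. In the second, r^2 / D dominates [ball_wake]. *)
have [h|h] := leP (r ^+ 2) (wake x * enorm3 x / 4).
  apply: (@dominatedW _ _ _ (5 `^ (`|a| + `|b|))) => //.
    by rewrite lerDl !mulr_ge0 ?powR_ge0.
  apply: dominated_comparable => // [|y yr]; first lra.
  have [yx xy] := enorm3_ball _ _ _ yr.
  have wy := wU _ yr.
  split; [rewrite /ball_size; lra|rewrite /ball_size; lra|lra|].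
  have : r ^+ 2 / enorm3 x <= wake x / 4 by rewrite ler_pdivrMr//; lra.
  suff : wake x <= 4 * wake y by rewrite /ball_wake; lra.
  have y0 : 0 < enorm3 y by lra.
  rewrite -(ler_pM2l y0); have := wake_quasi_lip y x.
  rewrite enorm3_distC.
  have : enorm3 (y - x) ^+ 2 <= r ^+ 2.
    by apply: lerXn2r; rewrite ?nnegrE ?enorm3_ge0//; lra.
  have : wake x * enorm3 x <= wake x * (2 * enorm3 y).
    by apply: ler_wpM2l; lra.
  lra.
apply: (@dominatedW _ _ _ (4 `^ `|a - b0| * 2 `^ (b - 2 * b0) * 10 `^ (- b0))) => //.
  by rewrite lerDr powR_ge0.
have W10 : ball_wake x r <= 10 * (r ^+ 2 / ball_size x r).
  suff : wake x <= 4 * (r ^+ 2 / enorm3 x) by rewrite /ball_wake; lra.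
  by rewrite mulrA ler_pdivlMr//; lra.
exists (4 `^ `|a - b0| * 2 `^ (b - 2 * b0) *
  (ball_wake x r `^ (b - b0) * ball_size x r `^ (a - b0))), 0, b0, b0; split.
- by rewrite !mulr_ge0 ?powR_ge0.
- by rewrite lexx; lra.
- by rewrite cb0.
- by rewrite cb0.
split.
  rewrite -!mulrA ler_pM2l ?powR_gt0// ler_pM2l ?powR_gt0//.
  (* Writing r^2 = (r^2 / D) D splits the power into one of F, up to a constant, and one of D. *)
  have -> : r `^ (0 + b0 + b0) =
      (r ^+ 2 / ball_size x r) `^ b0 * ball_size x r `^ b0.
    rewrite -powRM//; last lra.
    rewrite mulfVK ?gt_eqF//; last lra.
    by rewrite expr2 powRM ?ltW// -powRDn// add0r.
  have : (r ^+ 2 / ball_size x r) `^ b0 <= 10 `^ (- b0) * ball_wake x r `^ b0.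
    rewrite (powRN _ b0) [leRHS]mulrC ler_pdivlMr ?powR_gt0// -powRM//.
    by apply: powR_le_nonpos => //; lra.
  rewrite /ball_weight.
  have -> : ball_size x r `^ a = ball_size x r `^ (a - b0) * ball_size x r `^ b0.
    by rewrite -powRDn; [congr powR; lra|lra].
  have -> : ball_wake x r `^ b = ball_wake x r `^ (b - b0) * ball_wake x r `^ b0.
    by rewrite -powRDn; [congr powR; lra|lra].
  have := powR_ge0 (ball_wake x r) (b - b0).
  have := powR_ge0 (ball_size x r) (a - b0); have := powR_ge0 (ball_size x r) b0.
  move: (ball_size x r `^ (a - b0)) (ball_size x r `^ b0) (10 `^ (- b0))
    (ball_wake x r `^ (b - b0)) (ball_wake x r `^ b0)
    ((r ^+ 2 / ball_size x r) `^ b0) => d1 d2 t w1 w2 u d20 d10 w10 hh.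
  rewrite (_ : w1 * _ = w1 * (d1 * d2) * u); last by ring.
  rewrite (_ : t * _ = w1 * (d1 * d2) * (t * w2)); last by ring.
  by rewrite ler_wpM2l// !mulr_ge0.
move=> y yr; have [yx xy] := enorm3_ball _ _ _ yr.
have ey := enorm3_ge0 y; have wy := wake_ge1 y.
rewrite powRr0 mul1r aniso_weight_wakeE.
have -> : wake y `^ b = wake y `^ (b - b0) * wake y `^ b0.
  by rewrite -powRDn; [congr powR; lra|lra].
have h1 : wake y `^ (b - b0) <= 2 `^ (b - b0) * ball_wake x r `^ (b - b0).
  rewrite -powRM//; last lra.
  by apply: powR_le_nonneg; have := wU _ yr; lra.
have h2 : (1 + enorm3 y) `^ (a - b0) <= 4 `^ `|a - b0| * ball_size x r `^ (a - b0).
  by apply: powR_comparable; rewrite /ball_size; lra.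
apply: (@le_trans _ _ ((1 + enorm3 y) `^ a *
  ((2 `^ (b - b0) * ball_wake x r `^ (b - b0)) *
  (2 `^ (- b0) * (1 + enorm3 y) `^ (- b0) *
    ((1 + `|y.1.2|) `^ b0 * (1 + `|y.2|) `^ b0))))).
  apply: ler_wpM2l; first exact: powR_ge0.
  apply: ler_pM; rewrite ?powR_ge0//.
  exact: wake_powR_le.
rewrite [leLHS](_ : _ = (1 + enorm3 y) `^ (a - b0) *
  (2 `^ (b - 2 * b0) * ball_wake x r `^ (b - b0) *
    ((1 + `|y.1.2|) `^ b0 * (1 + `|y.2|) `^ b0))); last first.
  have -> : b - 2 * b0 = (b - b0) + (- b0) by lra.
  rewrite (powRDn _ a (- b0)); last lra.
  rewrite (powRDn _ (b - b0) (- b0))//.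
  by ring.
rewrite [leRHS](_ : _ = 4 `^ `|a - b0| * ball_size x r `^ (a - b0) *
  (2 `^ (b - 2 * b0) * ball_wake x r `^ (b - b0) *
    ((1 + `|y.1.2|) `^ b0 * (1 + `|y.2|) `^ b0))); last by ring.
by rewrite ler_wpM2r// !mulr_ge0 ?powR_ge0.
Qed.

(** Three regimes: r <= 1, then |x| <= 2 r, then |x| > 2 r. The hypotheses enter through 1 + b0 > 0
    and e > -(3 + 2 b0), which keep the least exponent [c] above -1. *)
Lemma aniso_weight_dominated a b : -1 < b -> -3 < a + b ->
  exists c C : R, [/\ -1 < c, c <= 0, 0 < C &
    forall x r, 0 < r -> dominated a b c C x r].
Proof.
move=> b1 ab3; set b0 := Num.min b 0; set e := Num.min (a + b - 2 * b0) 0.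
set c := Num.min (e / (3 + 2 * b0)) (e * (1 + b0) / (3 + 2 * b0) + b0).
have e0 : e <= 0 by rewrite /e ge_min lexx orbT.
have b00 : b0 <= 0 by rewrite /b0 ge_min lexx orbT.
have b01 : -1 < b0 by rewrite /b0 lt_min b1; lra.
have d0 : 0 < 3 + 2 * b0 by lra.
have eL : - (3 + 2 * b0) < e.
  rewrite /e lt_min; apply/andP; split; last lra.
  by rewrite /b0; case: (leP b 0) => ?; lra.
have c1 : -1 < e / (3 + 2 * b0) by rewrite ltr_pdivlMr//; lra.
have c2 : e * (1 + b0) / (3 + 2 * b0) <= 0.
  by rewrite ler_pdivrMr// mul0r mulr_le0_ge0//; lra.
set C1 : R := 4 `^ (`|a| + `|b|).
set C2 : R := 2 `^ (b - 2 * b0) * 4 `^ `|e + 2 * b0| * 16 `^ `|b|.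
set C3 : R := 5 `^ (`|a| + `|b|) +
    4 `^ `|a - b0| * 2 `^ (b - 2 * b0) * 10 `^ (- b0).
have C10 : 0 < C1 by rewrite powR_gt0.
have C20 : 0 < C2 by rewrite !mulr_gt0 ?powR_gt0.
have C30 : 0 < C3 by rewrite addr_gt0 ?mulr_gt0 ?powR_gt0.
exists c, (C1 + C2 + C3); split; [| |lra|].
- rewrite /c lt_min c1 /=.
  suff : -1 - b0 < e * (1 + b0) / (3 + 2 * b0) by lra.
  by rewrite mulrAC; nra.
- by rewrite /c ge_min; apply/orP; right; lra.
move=> x r r0.
have cb0 : c <= b0 by rewrite /c ge_min; apply/orP; right; lra.
have [r1|r1] := leP r 1.
  apply: (@dominatedW _ _ _ C1) => //; first lra.
  by apply: dominated_small; [rewrite r0|lra].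
have [xr|xr] := leP (enorm3 x) (2 * r).
  apply: (@dominatedW _ _ _ C2) => //; first lra.
  apply: dominated_center => //; first lra.
  - by rewrite /c ge_min lexx.
  - by rewrite /c ge_min lexx orbT.
apply: (@dominatedW _ _ _ C3) => //; first lra.
by apply: dominated_far => //; lra.
Qed.

End upper_bound.

(** * One-dimensional integrals *)

Section one_dimensional.
Context {R : realType}.
Notation mu := (@lebesgue_measure R).
Implicit Types (a b c g r t : R).

Lemma is_derive_powR_shift g t : -1 < t ->
  is_derive t 1 (fun t => (1 + t) `^ g) (g * (1 + t) `^ (g - 1)).
Proof.
move=> t1; have t0 : 0 < 1 + t by lra.
have h1 := is_derive1_powR g t0.
have h2 : is_derive t 1 (fun t : R => 1 + t) 1.
  by rewrite -[X in is_derive _ _ _ X]add0r; exact: is_deriveD.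
have := is_derive1_comp h1 h2.
by rewrite mulr1.
Qed.

Lemma continuous_powR_shift g t : -1 < t ->
  {for t, continuous (fun t => (1 + t) `^ g)}.
Proof.
move=> t1; apply: differentiable_continuous; apply/derivable1_diffP.
by have [] := is_derive_powR_shift g t t1.
Qed.

Lemma integral_powR_shift g b : -1 < g -> 0 < b ->
  (\int[mu]_(t in `[0%R, b]) ((1 + t) `^ g)%:E =
   (((1 + b) `^ (g + 1) - 1) / (g + 1))%:E)%E.
Proof.
move=> g1 b0; have g10 : g + 1 != 0 by rewrite gt_eqF//; lra.
have dF t : -1 < t -> is_derive t 1 (fun t => (g + 1)^-1 * (1 + t) `^ (g + 1))
   ((1 + t) `^ g).
  move=> t1; have h := is_derive_powR_shift (g + 1) t t1.
  apply: (is_derive_eq (is_deriveZ (g + 1)^-1 h)).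
  by rewrite /GRing.scale /= mulrA mulVf// mul1r addrK.
have cF t : -1 < t -> {for t, continuous (fun t => (g + 1)^-1 * (1 + t) `^ (g + 1))}.
  move=> t1; apply: differentiable_continuous; apply/derivable1_diffP.
  by have [] := dF t t1.
rewrite (@continuous_FTC2 _ _ (fun t => (g + 1)^-1 * (1 + t) `^ (g + 1)))//.
- by rewrite addr0 powR1 -EFinB mulrC mulr1 mulrBl mul1r.
- apply: continuous_in_subspaceT => t /set_mem /=; rewrite in_itv /= => /andP[t0 _].
  by apply: continuous_powR_shift; lra.
- split.
  + move=> t; rewrite in_itv/= => /andP[t0 _].
    by have [] := dF t ltac:(lra).
  + by apply: cvg_at_right_filter; apply: cF; lra.
  + by apply: cvg_at_left_filter; apply: cF; lra.
- move=> t; rewrite in_itv/= => /andP[t0 _].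
  by rewrite derive1E; have [_ ->] := dF t ltac:(lra).
Qed.

Lemma measurable_powR_abs g :
  measurable_fun [set: R] (fun t => (1 + `|t|) `^ g).
Proof.
apply: (measurableT_comp (measurable_powR g)).
by apply: measurable_funD => //; exact: measurableT_comp.
Qed.

(** The left side is the integral of (1 + |t|)^g over [-3 r, 3 r]. As r > 1, (1 + 3 r)^(g + 1) <= (4
    r)^(g + 1) <= 4 r^(g + 1). *)
Lemma powR_shift_le c g r : -1 < c -> c <= g -> g <= 0 -> 1 < r ->
  ((1 + 3 * r) `^ (g + 1) - 1) / (g + 1) + ((1 + 3 * r) `^ (g + 1) - 1) / (g + 1)
    <= 8 / (1 + c) * r `^ (1 + g).
Proof.
move=> c1 cg g0 r1; have r0 : 0 < r by lra.
have p1 : (1 + 3 * r) `^ (g + 1) <= 4 * r `^ (1 + g).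
  apply: (@le_trans _ _ ((4 * r) `^ (g + 1))).
    by apply: powR_le_nonneg; lra.
  rewrite powRM//; last lra.
  rewrite (addrC 1 g) ler_wpM2r ?powR_ge0//.
  by rewrite -[leRHS]powRr1// ler_powR//; lra.
have g10 : 0 < g + 1 by lra.
apply: (@le_trans _ _ (8 / (g + 1) * r `^ (1 + g))).
  rewrite -mulrDl (mulrAC 8) ler_wpM2r ?invr_ge0 ?ltW//.
  by have := powR_ge0 r (1 + g); lra.
rewrite ler_wpM2r ?powR_ge0// ler_wpM2l// lef_pV2 ?posrE; lra.
Qed.

(** If r <= 1 the integrand is at most 1 <= r^g; if |a| > 2 r then |t| >= r and it is at most r^g.
    Otherwise the interval lies in [-3 r, 3 r], where the integral is explicit. *)
Lemma integral_powR_abs c g a r : -1 < c -> c <= g <= 0 -> 0 < r ->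
  (\int[mu]_(t in `](a - r)%R, (a + r)%R[) ((1 + `|t|) `^ g)%:E
    <= (8 / (1 + c) * r `^ (1 + g))%:E)%E.
Proof.
move=> c1 /andP[cg g0] r0.
have mf D : measurable_fun D (fun t => ((1 + `|t|) `^ g)%:E).
  by apply/measurable_EFinP; apply: measurable_funTS; exact: measurable_powR_abs.
have C8 : 8 <= 8 / (1 + c) by rewrite ler_pdivlMr; lra.
have cstb (K : R) : 0 <= K -> K <= r `^ g ->
    (forall t, a - r < t < a + r -> (1 + `|t|) `^ g <= K) ->
  (\int[mu]_(t in `](a - r)%R, (a + r)%R[) ((1 + `|t|) `^ g)%:E
    <= (8 / (1 + c) * r `^ (1 + g))%:E)%E.
  move=> K0 Kr h.
  apply: (@le_trans _ _ (\int[mu]_(t in `](a - r)%R, (a + r)%R[) (cst K%:E t)))%E.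
    apply: ge0_le_integral => //; exact: mf.
  rewrite integral_cst//= lebesgue_measure_itv/= lte_fin.
  have -> : a - r < a + r by lra.
  rewrite -EFinB -EFinM lee_fin powRDn// powRr1 ?(ltW r0)//.
  apply: (@le_trans _ _ (r `^ g * (2 * r))).
    rewrite (_ : a + r - (a - r) = 2 * r); last by ring.
    by rewrite ler_wpM2r// mulr_ge0// (ltW r0).
  rewrite (_ : r `^ g * (2 * r) = 2 * (r * r `^ g)); last by ring.
  by rewrite ler_wpM2r ?mulr_ge0 ?powR_ge0 ?(ltW r0)//; lra.
have [r1|r1] := leP r 1.
  apply: (cstb 1) => //.
    by rewrite -[leLHS](powRr0 r) ger_powR// r0.
  by move=> t _; rewrite -[leRHS](powRr0 (1 + `|t|)) ler_powR// lerDl.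
have [ar|ar] := leP `|a| (2 * r); last first.
  apply: (cstb (r `^ g)) => //; first exact: powR_ge0.
  move=> t /andP[t1 t2]; apply: powR_le_nonpos => //.
  suff : r <= `|t| by lra.
  have : `|a| <= `|t| + `|a - t| by rewrite -{1}(subrKC t a) ler_normD.
  suff : `|a - t| <= r by lra.
  by rewrite ler_norml; lra.
have b0 : 0 < 3 * r by lra.
apply: (@le_trans _ _ (\int[mu]_(t in `[(- (3 * r))%R, 0%R[ `|` `[0%R, (3 * r)%R])
    ((1 + `|t|) `^ g)%:E))%E.
  apply: ge0_subset_integral => //.
  - exact: measurableU.
  - exact: mf.
  - move=> t /=; rewrite !in_itv/= => /andP[t1 t2].
    move: ar; rewrite ler_norml => /andP[a1 a2].
    by have [t0|t0] := leP 0 t; [right|left]; lra.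
rewrite ge0_integral_setU//=; [|exact: mf|]; last first.
  rewrite disj_set2E; apply/eqP/seteqP; split=> // t [] /=.
  by rewrite !in_itv/=; lra.
rewrite integral_itv_bndo_bndc; last exact: mf.
have pos : (\int[mu]_(t in `[0%R, (3 * r)%R]) ((1 + `|t|) `^ g)%:E =
    \int[mu]_(t in `[0%R, (3 * r)%R]) ((1 + t) `^ g)%:E)%E.
  apply: eq_integral => t /set_mem/=; rewrite in_itv/= => /andP[t0 _].
  by rewrite ger0_norm.
have neg : (\int[mu]_(t in `[(- (3 * r))%R, 0%R]) ((1 + `|t|) `^ g)%:E =
    \int[mu]_(t in `[0%R, (3 * r)%R]) ((1 + `|t|) `^ g)%:E)%E.
  rewrite -{1}oppr0 (@integration_by_substitution_oppr _ (fun t => (1 + `|t|) `^ g)).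
  - by apply: eq_integral => t _ /=; rewrite normrN.
  - lra.
  - apply: continuous_subspaceT => t.
    apply: (@continuous_comp _ _ _ (fun t : R => `|t|) (fun t => (1 + t) `^ g)).
      exact: norm_continuous.
    by apply: continuous_powR_shift; have := normr_ge0 t; lra.
rewrite neg pos integral_powR_shift; [|lra|exact: b0].
by rewrite -EFinD lee_fin; exact: powR_shift_le.
Qed.
End one_dimensional.

(** * Measurability and integrals in three dimensions *)

(** Tonelli's theorem, once both factors are extended by zero outside their sides. *)
Lemma ge0_integral_setX {d1 d2} {T1 : measurableType d1} {T2 : measurableType d2}
    {R : realType} (m1 : {sigma_finite_measure set T1 -> \bar R})
    (m2 : {sigma_finite_measure set T2 -> \bar R})
    (D1 : set T1) (D2 : set T2) (f1 : T1 -> \bar R) (f2 : T2 -> \bar R) :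
  measurable D1 -> measurable D2 ->
  measurable_fun D1 f1 -> measurable_fun D2 f2 ->
  (forall x, D1 x -> 0 <= f1 x)%E -> (forall x, D2 x -> 0 <= f2 x)%E ->
  (\int[m1 \x m2]_(z in D1 `*` D2) (f1 z.1 * f2 z.2) =
    \int[m1]_(x in D1) f1 x * \int[m2]_(x in D2) f2 x)%E.
Proof.
move=> mD1 mD2 mf1 mf2 f10 f20.
rewrite integral_mkcond [X in (X * _)%E]integral_mkcond.
rewrite [X in (_ * X)%E]integral_mkcond.
have {}mf1 : measurable_fun setT (f1 \_ D1) by exact/(measurable_restrictT _ _).1.
have {}mf2 : measurable_fun setT (f2 \_ D2) by exact/(measurable_restrictT _ _).1.
have {}f10 x : (0 <= (f1 \_ D1) x)%E by exact: erestrict_ge0.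
have {}f20 x : (0 <= (f2 \_ D2) x)%E by exact: erestrict_ge0.
rewrite (_ : _ \_ _ = fun z => (f1 \_ D1) z.1 * (f2 \_ D2) z.2)%E; last first.
  apply/funext => -[x y] /=; rewrite /patch in_setX /=.
  by case: (x \in D1); case: (y \in D2); rewrite ?mul0e ?mule0.
rewrite fubini_tonelli1.
- rewrite /fubini_F /=.
  under eq_integral do rewrite ge0_integralZl//.
  by rewrite ge0_integralZr// integral_ge0.
- by apply: emeasurable_funM; exact: measurableT_comp.
- by move=> z; exact: mule_ge0.
Qed.

(* The library's sigma-finiteness of a product measure is shadowed by the
   instance for probability measures, whence this named copy of the product. *)
Definition lebesgue2 {R : realType} :
    set (measurableTypeR R * measurableTypeR R) -> \bar R :=
  (@lebesgue_measure R \x @lebesgue_measure R)%E.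

HB.instance Definition _ (R : realType) :=
  Measure.copy (@lebesgue2 R) (@lebesgue_measure R \x @lebesgue_measure R)%E.

Lemma sigma_finite_lebesgue2 (R : realType) : sigma_finite setT (@lebesgue2 R).
Proof.
pose I (n : nat) : set (measurableTypeR R) := [set` `]- n%:R, n%:R[].
have mI n : measurable (I n) by exact: measurable_itv.
exists (fun n => I n `*` I n).
  rewrite predeqE => -[x y]; split => // _.
  exists (Num.truncn `|x| + Num.truncn `|y|).+1 => //=.
  rewrite /I /= !in_itv /= -!ltr_norml.
  have h : `|x| < (Num.truncn `|x|).+1%:R by exact: truncnS_gt.
  have h' : `|y| < (Num.truncn `|y|).+1%:R by exact: truncnS_gt.
  by split; [apply: lt_le_trans h _|apply: lt_le_trans h' _];
    rewrite ler_nat ltnS ?leq_addr ?leq_addl.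
move=> n; split; first exact: measurableX.
rewrite (_ : lebesgue2 _ = lebesgue_measure (I n) * lebesgue_measure (I n))%E.
  by rewrite lebesgue_measure_itv /=; case: ifP => _; rewrite -?EFinB -?EFinM ?mule0 ltry.
exact: product_measure1E.
Qed.

HB.instance Definition _ (R : realType) :=
  Measure_isSigmaFinite.Build _ _ _ (@lebesgue2 R) (sigma_finite_lebesgue2 R).

Section measure3.
Context {R : realType}.
Local Notation mR := (measurableTypeR R).
Notation mu := (@lebesgue_measure R).
Implicit Types (x y : R3 R) (a b c r : R).

Lemma measurable_enorm3 : measurable_fun [set: R3 mR] (@enorm3 R).
Proof.
apply: (measurableT_comp (continuous_measurable_fun (@sqrt_continuous R))).
apply: measurable_funD; [apply: measurable_funD|]; apply: measurable_funX => //.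
- exact: (measurableT_comp measurable_fst measurable_fst).
- exact: (measurableT_comp measurable_snd measurable_fst).
Qed.

Lemma measurable_wake : measurable_fun [set: R3 mR] (@wake R).
Proof.
apply: measurable_funB.
  by apply: measurable_funD => //; exact: measurable_enorm3.
exact: (measurableT_comp measurable_fst measurable_fst).
Qed.

Lemma measurable_aniso_weight a b :
  measurable_fun [set: R3 mR] (aniso_weight a b).
Proof.
apply: measurable_funM.
  apply: (measurableT_comp (measurable_powR a)).
  by apply: measurable_funD => //; exact: measurable_enorm3.
exact: (measurableT_comp (measurable_powR b) measurable_wake).
Qed.

Lemma measurable_eball3 x r : measurable (eball3 x r : set (R3 mR)).
Proof.
have m : measurable_fun [set: R3 mR] (fun y : R3 mR => enorm3 (y - x)).
  apply: (measurableT_comp measurable_enorm3).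
  apply: measurable_fun_pair; first apply: measurable_fun_pair.
  - apply: measurable_funB => //.
    exact: (measurableT_comp measurable_fst measurable_fst).
  - apply: measurable_funB => //.
    exact: (measurableT_comp measurable_snd measurable_fst).
  - exact: measurable_funB.
have := m measurableT _ (measurable_itv `]-oo, r[).
by rewrite setTI; congr measurable.
Qed.

Definition box3 (i j k : interval R) : set (R3 R) :=
  ([set` i] `*` [set` j]) `*` [set` k].

Lemma measurable_box3 i j k : measurable (box3 i j k : set (R3 mR)).
Proof. by apply: measurableX => //; apply: measurableX. Qed.

Lemma lebesgue3_box i j k :
  lebesgue3 R (box3 i j k) = (mu [set` i] * mu [set` j] * mu [set` k])%E.
Proof.
rewrite (_ : lebesgue3 R _ = (mu \x mu)%E ([set` i] `*` [set` j]) * mu [set` k])%E.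
  by rewrite product_measure1E.
by apply: product_measure1E => //; exact: measurableX.
Qed.

Lemma lebesgue3_cube x s : 0 <= s ->
  lebesgue3 R (box3 `]x.1.1 - s, x.1.1 + s[ `]x.1.2 - s, x.1.2 + s[
    `]x.2 - s, x.2 + s[) = ((2 * s) ^+ 3)%:E.
Proof.
move=> s0; rewrite lebesgue3_box.
have h (t : R) : mu `]t - s, t + s[%classic = (2 * s)%:E.
  rewrite lebesgue_measure_itv/= lte_fin.
  have [ts|ts] := ltP (t - s) (t + s).
    by rewrite -EFinB; congr EFin; ring.
  by congr EFin; lra.
by rewrite !h -!EFinM; congr EFin; ring.
Qed.

Lemma eball3_sub_cube x r : eball3 x r `<=`
  box3 `]x.1.1 - r, x.1.1 + r[ `]x.1.2 - r, x.1.2 + r[ `]x.2 - r, x.2 + r[.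
Proof.
move=> y; rewrite /eball3 /= => yr.
have [h1 h2 h3] := coord_le_enorm3 (y - x).
have /= := (le_lt_trans h1 yr, le_lt_trans h2 yr, le_lt_trans h3 yr).
rewrite /= !ltr_norml /= => -[[/andP[? ?] /andP[? ?]] /andP[? ?]].
by rewrite /box3 /= !in_itv /=; split; [split|]; lra.
Qed.

(** Half-side r / 2 is enough, since 3 (r / 2)^2 < r^2. *)
Lemma cube_sub_eball3 x r : 0 < r ->
  box3 `]x.1.1 - r / 2, x.1.1 + r / 2[ `]x.1.2 - r / 2, x.1.2 + r / 2[
    `]x.2 - r / 2, x.2 + r / 2[ `<=` eball3 x r.
Proof.
move=> r0 y; rewrite /box3 /= !in_itv /= => -[[h1 h2] h3].
have h t s : s - r / 2 < t < s + r / 2 -> (t - s) ^+ 2 <= r ^+ 2 / 4.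
  move=> ts; rewrite -(real_normK (num_real (t - s))).
  rewrite (_ : r ^+ 2 / 4 = (r / 2) ^+ 2); last by field.
  by apply: lerXn2r; rewrite ?nnegrE ?normr_ge0 ?ler_norml; lra.
rewrite /eball3 /= -(@ltr_pXn2r _ 2) ?nnegrE ?enorm3_ge0 ?(ltW r0)//.
rewrite sqr_enorm3 /=; have := h _ _ h1; have := h _ _ h2; have := h _ _ h3.
have : 0 < r ^+ 2 by rewrite exprn_gt0.
lra.
Qed.

(** The ball lies between concentric cubes of sides r and 2 r; the averages only depend on its
    volume up to constants. *)
Lemma lebesgue3_eball x r : 0 < r ->
  exists2 v : R, lebesgue3 R (eball3 x r) = v%:E & r ^+ 3 <= v <= 8 * r ^+ 3.
Proof.
move=> r0.
have h1 : (lebesgue3 R (eball3 x r) <= (8 * r ^+ 3)%:E)%E.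
  rewrite (_ : 8 * r ^+ 3 = (2 * r) ^+ 3); last by ring.
  rewrite -(lebesgue3_cube x) ?(ltW r0)//; apply: le_measure; last exact: eball3_sub_cube.
  - by rewrite inE; exact: measurable_eball3.
  - by rewrite inE; exact: measurable_box3.
have h2 : ((r ^+ 3)%:E <= lebesgue3 R (eball3 x r))%E.
  rewrite [X in (X%:E <= _)%E](_ : _ = (2 * (r / 2)) ^+ 3); last by field.
  rewrite -(lebesgue3_cube x); last by rewrite divr_ge0// (ltW r0).
  apply: le_measure; last exact: cube_sub_eball3.
  - by rewrite inE; exact: measurable_box3.
  - by rewrite inE; exact: measurable_eball3.
move: h1 h2; case: (lebesgue3 R (eball3 x r)) => [v| |] //=.
by rewrite !lee_fin => h1 h2; exists v => //; rewrite h1 h2.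
Qed.

Lemma average3_le x r f X : 0 < r -> 0 <= X ->
  (\int[lebesgue3 R]_(y in eball3 x r) f y <= (X * r ^+ 3)%:E)%E ->
  (average3 (eball3 x r) f <= X%:E)%E.
Proof.
move=> r0 X0 h; have [v vE /andP[v1 v2]] := lebesgue3_eball x r r0.
have r3 : 0 < r ^+ 3 by rewrite exprn_gt0.
have v0 : 0 < v by lra.
rewrite /average3 vE inver gt_eqF// lee_pdivrMl// -EFinM (le_trans h)//.
by rewrite lee_fin mulrC ler_wpM2r.
Qed.

Lemma average3_ge x r f X : 0 < r -> 0 <= X ->
  ((X * r ^+ 3)%:E <= \int[lebesgue3 R]_(y in eball3 x r) f y)%E ->
  ((X / 8)%:E <= average3 (eball3 x r) f)%E.
Proof.
move=> r0 X0 h; have [v vE /andP[v1 v2]] := lebesgue3_eball x r r0.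
have r3 : 0 < r ^+ 3 by rewrite exprn_gt0.
have v0 : 0 < v by lra.
rewrite /average3 vE inver gt_eqF// lee_pdivlMl// -EFinM (le_trans _ h)//.
rewrite lee_fin mulrA ler_pdivrMr// (mulrC v) -!mulrA ler_wpM2l//.
lra.
Qed.

Lemma measurable_powR_abs_prod g1 g2 g3 : measurable_fun [set: R3 mR]
  (fun y : R3 mR => (1 + `|y.1.1|) `^ g1 * (1 + `|y.1.2|) `^ g2 * (1 + `|y.2|) `^ g3).
Proof.
apply: measurable_funM; [apply: measurable_funM|].
- apply: (measurableT_comp (measurable_powR_abs g1)).
  exact: (measurableT_comp measurable_fst measurable_fst).
- apply: (measurableT_comp (measurable_powR_abs g2)).
  exact: (measurableT_comp measurable_snd measurable_fst).
- exact: (measurableT_comp (measurable_powR_abs g3)).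
Qed.

(** Enlarging the ball to a cube separates the variables; each one-dimensional integral contributes
    a factor r^(1 + g_i). *)
Lemma average3_prod_le c x r g1 g2 g3 : -1 < c -> 0 < r ->
  c <= g1 <= 0 -> c <= g2 <= 0 -> c <= g3 <= 0 ->
  (\int[lebesgue3 R]_(y in eball3 x r) ((1 + `|y.1.1|) `^ g1 *
      (1 + `|y.1.2|) `^ g2 * (1 + `|y.2|) `^ g3)%:E
    <= ((8 / (1 + c)) ^+ 3 * r `^ (g1 + g2 + g3) * r ^+ 3)%:E)%E.
Proof.
move=> c1 r0 h1 h2 h3.
have mf g D : measurable_fun (D : set mR) (fun t => ((1 + `|t|) `^ g)%:E).
  by apply/measurable_EFinP; apply: measurable_funTS; exact: measurable_powR_abs.
have p0 (g t : R) : (0 <= ((1 + `|t|) `^ g)%:E)%E by rewrite lee_fin powR_ge0.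
set B := box3 `]x.1.1 - r, x.1.1 + r[ `]x.1.2 - r, x.1.2 + r[ `]x.2 - r, x.2 + r[.
apply: (@le_trans _ _ (\int[lebesgue3 R]_(y in B) (((1 + `|y.1.1|) `^ g1)%:E *
      ((1 + `|y.1.2|) `^ g2)%:E * ((1 + `|y.2|) `^ g3)%:E)))%E.
  apply: ge0_subset_integral => //.
  - exact: measurable_eball3.
  - exact: measurable_box3.
  - apply/measurable_EFinP; apply: measurable_funTS.
    exact: measurable_powR_abs_prod.
  - exact: eball3_sub_cube.
pose f1 (t : mR) := ((1 + `|t|) `^ g1)%:E.
pose f2 (t : mR) := ((1 + `|t|) `^ g2)%:E.
pose f3 (t : mR) := ((1 + `|t|) `^ g3)%:E.
pose I1 : set mR := [set` `]x.1.1 - r, x.1.1 + r[].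
pose I2 : set mR := [set` `]x.1.2 - r, x.1.2 + r[].
pose I3 : set mR := [set` `]x.2 - r, x.2 + r[].
have mI1 : measurable I1 by exact: measurable_itv.
have mI2 : measurable I2 by exact: measurable_itv.
have mI3 : measurable I3 by exact: measurable_itv.
have E2 : (\int[mu \x mu]_(z in I1 `*` I2) (f1 z.1 * f2 z.2) =
    \int[mu]_(t in I1) f1 t * \int[mu]_(t in I2) f2 t)%E.
  by apply: ge0_integral_setX => // *; [exact: mf|exact: mf|exact: p0|exact: p0].
have E3 : (\int[lebesgue3 R]_(y in (I1 `*` I2) `*` I3)
    (f1 y.1.1 * f2 y.1.2 * f3 y.2) =
    \int[mu \x mu]_(z in I1 `*` I2) (f1 z.1 * f2 z.2) * \int[mu]_(t in I3) f3 t)%E.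
  apply: (@ge0_integral_setX _ _ _ _ R (@lebesgue2 R) mu (I1 `*` I2) I3
    (fun z => f1 z.1 * f2 z.2)%E f3) => //.
  - exact: measurableX.
  - apply: measurable_funTS; apply: emeasurable_funM.
    + exact: (measurableT_comp (mf g1 setT)).
    + exact: (measurableT_comp (mf g2 setT)).
  - exact: mf.
  - by move=> z _; apply: mule_ge0; exact: p0.
  - by move=> t _; exact: p0.
rewrite [leLHS](_ : _ = \int[mu]_(t in I1) f1 t * \int[mu]_(t in I2) f2 t *
  \int[mu]_(t in I3) f3 t)%E; last by rewrite -E2 -E3.
apply: (@le_trans _ _ ((8 / (1 + c) * r `^ (1 + g1))%:E *
  (8 / (1 + c) * r `^ (1 + g2))%:E * (8 / (1 + c) * r `^ (1 + g3))%:E)%E).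
  have i1 : (\int[mu]_(t in I1) f1 t <= (8 / (1 + c) * r `^ (1 + g1))%:E)%E.
    exact: integral_powR_abs.
  have i2 : (\int[mu]_(t in I2) f2 t <= (8 / (1 + c) * r `^ (1 + g2))%:E)%E.
    exact: integral_powR_abs.
  have i3 : (\int[mu]_(t in I3) f3 t <= (8 / (1 + c) * r `^ (1 + g3))%:E)%E.
    exact: integral_powR_abs.
  have n1 : (0 <= \int[mu]_(t in I1) f1 t)%E by apply: integral_ge0 => t _; exact: p0.
  have n2 : (0 <= \int[mu]_(t in I2) f2 t)%E by apply: integral_ge0 => t _; exact: p0.
  have n3 : (0 <= \int[mu]_(t in I3) f3 t)%E by apply: integral_ge0 => t _; exact: p0.
  apply: lee_pmul; [exact: mule_ge0|exact: n3| |exact: i3].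
  exact: (lee_pmul n1 n2 i1 i2).
rewrite -!EFinM lee_fin !powRDn// powRr1 ?(ltW r0)// le_eqVlt; apply/orP; left.
by apply/eqP; ring.
Qed.

End measure3.

(** * Sufficiency *)

Section sufficiency.
Context {R : realType}.
Local Notation mR := (measurableTypeR R).
Implicit Types (x y : R3 R) (a b c p q r : R).

Lemma average3_upper a b : -1 < b -> -3 < a + b -> exists2 C : R, 0 < C &
  forall x r, 0 < r ->
    (average3 (eball3 x r) (fun y => (aniso_weight a b y)%:E)
      <= (C * ball_weight a b x r)%:E)%E.
Proof.
move=> b1 ab3; have [c [C [c1 c0 C0 h]]] := aniso_weight_dominated a b b1 ab3.
have c8 : 0 < 8 / (1 + c) by rewrite divr_gt0//; lra.
exists ((8 / (1 + c)) ^+ 3 * C) => [|x r r0].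
  by rewrite mulr_gt0// exprn_gt0.
have [K [g1 [g2 [g3 [K0 h1 h2 h3 [h4 h5]]]]]] := h x r r0.
have W0 := ball_weight_gt0 a b x r r0.
apply: average3_le => //.
  by rewrite ltW// mulr_gt0// mulr_gt0// exprn_gt0.
have mP : measurable_fun (eball3 x r : set (R3 mR)) (fun y : R3 mR =>
    ((1 + `|y.1.1|) `^ g1 * (1 + `|y.1.2|) `^ g2 * (1 + `|y.2|) `^ g3)%:E).
  apply/measurable_EFinP; apply: measurable_funTS.
  exact: measurable_powR_abs_prod.
apply: (@le_trans _ _ (\int[lebesgue3 R]_(y in eball3 x r) (K%:E *
  ((1 + `|y.1.1|) `^ g1 * (1 + `|y.1.2|) `^ g2 * (1 + `|y.2|) `^ g3)%:E)))%E.
  apply: ge0_le_integral.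
  - exact: measurable_eball3.
  - by move=> y _; rewrite lee_fin ltW// aniso_weight_gt0.
  - apply/measurable_EFinP; apply: measurable_funTS.
    exact: measurable_aniso_weight.
  - exact: measurable_funeM.
  - by move=> y yr; rewrite -EFinM lee_fin; exact: h5.
rewrite ge0_integralZl//; last exact: measurable_eball3.
apply: (@le_trans _ _ (K%:E *
   ((8 / (1 + c)) ^+ 3 * r `^ (g1 + g2 + g3) * r ^+ 3)%:E))%E.
  by apply: lee_wpmul2l => //; exact: average3_prod_le.
rewrite -EFinM lee_fin mulrA ler_wpM2r ?exprn_ge0 ?(ltW r0)//.
rewrite mulrCA -[leRHS]mulrA; apply: ler_wpM2l h4.
by rewrite exprn_ge0// ltW.
Qed.

Lemma average3_aniso_weight_ge0 a b x r :
  (0 <= average3 (eball3 x r) (fun y => (aniso_weight a b y)%:E))%E.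
Proof.
rewrite mule_ge0 ?inve_ge0 ?measure_ge0// integral_ge0// => y _.
by rewrite lee_fin ltW// aniso_weight_gt0.
Qed.

(** The weight is positive, so the value [+oo] of [negpow] does not occur, and the dual weight stays
    in the family. *)
Lemma negpow_aniso_weight a b p y : negpow (aniso_weight a b y) p^-1 =
  (aniso_weight (- (a / p)) (- (b / p)) y)%:E.
Proof.
rewrite /negpow inver powR_eq0 gt_eqF ?aniso_weight_gt0//=.
by rewrite -powRN aniso_weight_pow !mulrN.
Qed.

(** Both factors lie between 1 and 1 + 2 M, hence are comparable to 1. *)
Lemma aniso_weight_local_bound a b (M : R) y : enorm3 y <= M ->
  aniso_weight a b y <= (1 + 2 * M) `^ (`|a| + `|b|).
Proof.
move=> yM; have e0 := enorm3_ge0 y; have w1 := wake_ge1 y.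
have wy := wake_le y.
have k1 : 1 <= 1 + 2 * M by lra.
have := @aniso_weight_le _ (1 + 2 * M) 1 1 a b y.
by rewrite !powR1 !mulr1; apply; rewrite ?mulr_ege1//; lra.
Qed.

Lemma locally_integrable3_aniso_weight a b :
  locally_integrable3 (@aniso_weight R a b).
Proof.
split; first exact: measurable_aniso_weight.
move=> K /compact_bounded [M [_ /(_ (M + `|M| + 1))]].
(* [N] is positive and exceeds [M], the threshold beyond which every real bounds [K]. *)
set N := M + `|M| + 1 => bK.
have N0 : 0 < N by rewrite /N; have := ler_norm (- M); rewrite normrN; lra.
have {}bK y : K y -> `|y| <= N.
  by move=> Ky; apply: bK => //; rewrite /N; have := normr_ge0 M; lra.
pose cube : set (R3 R) := box3 `]0 - (N + 1), 0 + (N + 1)[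
  `]0 - (N + 1), 0 + (N + 1)[ `]0 - (N + 1), 0 + (N + 1)[.
have Kc : K `<=` cube.
  move=> y /bK; rewrite !prod_normE !ge_max => /andP[/andP[y1 y2] y3].
  move: y1 y2 y3; rewrite !ler_norml => /andP[? ?] /andP[? ?] /andP[? ?].
  by rewrite /cube /box3 /= !in_itv/=; split; [split|]; lra.
pose C : R := (1 + 2 * (3 * (N + 1))) `^ (`|a| + `|b|).
have C0 : 0 <= C by exact: powR_ge0.
apply: (@le_lt_trans _ _ (\int[lebesgue3 R]_(x in cube) (cst C%:E x)))%E; last first.
  rewrite integral_cst; last exact: measurable_box3.
  rewrite (_ : lebesgue3 R cube = ((2 * (N + 1)) ^+ 3)%:E).
    by rewrite -EFinM ltry.
  by apply: (@lebesgue3_cube _ 0); lra.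
(* The compact set [K] comes without a measurability proof, so the integrals are compared as suprema
   over the simple functions below the integrands. *)
rewrite integral_mkcond [leRHS]integral_mkcond.
rewrite [leLHS]ge0_integralTE; last first.
  by move=> x; apply: erestrict_ge0 => y _; rewrite lee_fin.
rewrite [leRHS]ge0_integralTE; last first.
  by move=> x; apply: erestrict_ge0 => y _; rewrite lee_fin.
apply: ereal_sup_le => _ [h /= hle <-]; exists h => // x.
apply: le_trans (hle x) _; rewrite /patch.
case: ifPn => [/set_mem Kx|_]; last by case: ifP => // _; rewrite lee_fin.
rewrite mem_set; last exact: Kc.
rewrite lee_fin gtr0_norm ?aniso_weight_gt0//.
apply: aniso_weight_local_bound.
apply: enorm3_le; first lra.
have [[]] := Kc _ Kx; rewrite /= !in_itv/= => h1 h2 h3.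
have sq (t : R) : 0 - (N + 1) < t < 0 + (N + 1) -> t ^+ 2 <= (N + 1) ^+ 2.
  move=> ht; rewrite -(real_normK (num_real t)).
  by apply: lerXn2r; rewrite ?nnegrE ?normr_ge0 ?ler_norml; lra.
have := sq _ h1; have := sq _ h2; have := sq _ h3.
by have := sqr_ge0 (N + 1); rewrite exprMn; lra.
Qed.

(** The upper bounds on b and a + b are the lower bounds required of the dual exponents -a / p and
    -b / p. Raising the dual average to the power p then cancels all powers of D and F. *)
Lemma muckenhoupt_aniso_weight q a b : 1 < q ->
  -1 < b < q - 1 -> -3 < a + b < 3 * (q - 1) ->
  muckenhoupt q (@aniso_weight R a b).
Proof.
move=> q1 /andP[b1 bq] /andP[ab1 abq].
set p := q - 1; have p0 : 0 < p by rewrite /p; lra.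
split.
- by move=> x; rewrite ltW// aniso_weight_gt0.
- exact: locally_integrable3_aniso_weight.
have [C1 C10 h1] := average3_upper a b b1 ab1.
have [] := average3_upper (- (a / p)) (- (b / p)).
- by rewrite ltrNr opprK ltr_pdivrMr//; rewrite /p; lra.
- by rewrite -opprD -mulrDl ltrNr opprK ltr_pdivrMr//; rewrite /p; lra.
move=> C2 C20 h2; exists (C1 * C2 `^ p).
  by rewrite mulr_gt0 ?powR_gt0.
move=> x r r0.
have -> : (fun y => negpow (aniso_weight a b y) (q - 1)^-1) =
    (fun y => (aniso_weight (- (a / p)) (- (b / p)) y)%:E).
  by apply/funext => y; rewrite negpow_aniso_weight.
have W1 := ball_weight_gt0 a b x r r0.
have W2 := ball_weight_gt0 (- (a / p)) (- (b / p)) x r r0.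
apply: (@le_trans _ _ ((C1 * ball_weight a b x r)%:E *
   (C2 * ball_weight (- (a / p)) (- (b / p)) x r)%:E `^ p))%E.
  have a1 := average3_aniso_weight_ge0 a b x r.
  have a2 := average3_aniso_weight_ge0 (- (a / p)) (- (b / p)) x r.
  apply: lee_pmul; [exact: a1|exact: poweR_ge0|exact: h1|].
  by apply: gt0_ler_poweR; rewrite ?in_itv/= ?leey ?lee_fin ?andbT ?(ltW p0)//;
    [rewrite ltW// mulr_gt0|exact: h2].
rewrite poweR_EFin -EFinM lee_fin powRM; [|lra|lra].
have D0 : 0 < ball_size x r by have := ball_size_ge1 x r r0; lra.
have F0 : 0 < ball_wake x r by have := ball_wake_ge1 x r r0; lra.
rewrite /ball_weight powRM ?powR_ge0// -!powRrM.
rewrite !mulNr !divfK ?gt_eqF// !powRN.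
rewrite le_eqVlt; apply/orP; left; apply/eqP; field.
by rewrite !gt_eqF ?powR_gt0.
Qed.

End sufficiency.

(** * Necessity *)

Lemma integral_ge_sum_disjoint {d} {T : measurableType d} {R : realType}
    (mu : {measure set T -> \bar R}) (E : nat -> set T) (B : set T)
    (f : T -> \bar R) (v : R) (n : nat) :
  (forall k, measurable (E k)) -> measurable B -> trivIset setT E ->
  (forall k, (k < n)%N -> E k `<=` B) -> measurable_fun setT f ->
  (forall x, 0 <= f x)%E ->
  (forall k, (k < n)%N -> v%:E <= \int[mu]_(x in E k) f x)%E ->
  ((n%:R * v)%:E <= \int[mu]_(x in B) f x)%E.
Proof.
move=> mE mB tE EB mf f0 Ev.
have mU : measurable (\big[setU/set0]_(k <- iota 0 n) E k).
  by apply: bigsetU_measurable => k _; exact: mE.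
apply: (@le_trans _ _ (\int[mu]_(x in \big[setU/set0]_(k <- iota 0 n) E k) f x))%E.
  rewrite ge0_integral_bigsetU//; last 3 first.
  - exact: iota_uniq.
  - exact: sub_trivIset tE.
  - exact: measurable_funTS.
  apply: (@le_trans _ _ (\sum_(k <- iota 0 n) v%:E))%E.
    rewrite sumEFin lee_fin big_const_seq count_predT size_iota iter_addr_0.
    by rewrite mulr_natl.
  rewrite big_seq [leRHS]big_seq; apply: lee_sum => k.
  by rewrite mem_iota add0n => /Ev.
apply: ge0_subset_integral => //; first exact: measurable_funTS.
move=> x; rewrite -bigcup_seq => -[k /=].
by rewrite mem_iota add0n => /EB; exact.
Qed.

(** * Lower bounds for averages by boxes *)

Section lower_bound.
Context {R : realType}.
Local Notation mR := (measurableTypeR R).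
Implicit Types (x y : R3 R) (a b l t H T L A S : R).

(** The side []t, 2 * t]] keeps the box at distance t from the x_1-axis; [l] and [t] are independent
    so that a box can follow the paraboloids. *)
Definition low_box a l t : set (R3 R) :=
  box3 `]a, a + l] `]t, 2 * t] `]0, t].

Lemma measurable_low_box a l t : measurable (low_box a l t : set (R3 mR)).
Proof. exact: measurable_box3. Qed.

Lemma lebesgue3_low_box a l t : 0 < l -> 0 < t ->
  lebesgue3 R (low_box a l t) = (l * t ^+ 2)%:E.
Proof.
move=> l0 t0; rewrite lebesgue3_box !lebesgue_measure_itv /= !lte_fin.
rewrite ltrDl l0 t0 ltr_pMl// ltr1n /=.
by rewrite -!EFinB -!EFinM; congr EFin; ring.
Qed.

(** The factor 8^3 comes from the radius 8 L, one more 8 from the volume of the ball, and the power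
    of 16 from [comparable_on]. *)
Definition low_const a b : R := (8 ^+ 4 * 16 `^ (`|a| + `|b|))^-1.

Lemma low_const_gt0 a b : 0 < low_const a b.
Proof. by rewrite invr_gt0 mulr_gt0 ?exprn_gt0 ?powR_gt0. Qed.

Definition comparable_on (E : set (R3 R)) A S := forall y, E y ->
  [/\ 1 + enorm3 y <= 16 * A, A <= 16 * (1 + enorm3 y),
      wake y <= 16 * S & S <= 16 * wake y].

Lemma integral_low_box_ge a b c l t A S : 0 < l -> 0 < t -> 0 < A -> 0 < S ->
  comparable_on (low_box c l t) A S ->
  ((A `^ a * S `^ b * (l * t ^+ 2) / 16 `^ (`|a| + `|b|))%:E <=
    \int[lebesgue3 R]_(y in low_box c l t) (aniso_weight a b y)%:E)%E.
Proof.
move=> l0 t0 A0 S0 h.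
apply: (@le_trans _ _ (\int[lebesgue3 R]_(y in low_box c l t)
    (cst (A `^ a * S `^ b / 16 `^ (`|a| + `|b|))%:E y)))%E.
  rewrite integral_cst; last exact: measurable_low_box.
  rewrite lebesgue3_low_box// -EFinM lee_fin le_eqVlt; apply/orP; left.
  by apply/eqP; ring.
apply: ge0_le_integral.
- exact: measurable_low_box.
- by move=> y _; rewrite lee_fin mulr_ge0 ?invr_ge0 ?mulr_ge0 ?powR_ge0.
- exact: measurable_cst.
- apply/measurable_EFinP; apply: measurable_funTS.
  exact: measurable_aniso_weight.
- move=> y /h[h1 h2 h3 h4]; rewrite lee_fin ler_pdivrMr ?powR_gt0// [leRHS]mulrC.
  exact: aniso_weight_ge.
Qed.

(* The boxes are disjoint because their second sides are dyadic. *)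
Lemma average3_dyadic_boxes a b (n : nat) L (c l A S : nat -> R) (t : R) :
  0 < L -> 0 < t ->
  (forall k, (k <= n)%N -> [/\ 0 < l k, 0 < A k & 0 < S k]) ->
  (forall k, (k <= n)%N -> comparable_on (low_box (c k) (l k) (2 ^+ k * t)) (A k) (S k)) ->
  (forall k, (k <= n)%N -> low_box (c k) (l k) (2 ^+ k * t) `<=` eball3 0 (8 * L)) ->
  (forall k, (k <= n)%N -> A n `^ a * S n `^ b * L ^+ 3 <=
     A k `^ a * S k `^ b * (l k * (2 ^+ k * t) ^+ 2)) ->
  ((low_const a b * n.+1%:R * (A n `^ a * S n `^ b))%:E <=
     average3 (eball3 (0 : R3 R)%R (8 * L)) (fun y => (aniso_weight a b y)%:E))%E.
Proof.
move=> L0 t0 pos comp sub big.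
have [ln0 An0 Sn0] := pos n (leqnn n).
have P0 : 0 < 16 `^ (`|a| + `|b|) :> R by rewrite powR_gt0.
have M0 : 0 < A n `^ a * S n `^ b by rewrite mulr_gt0 ?powR_gt0.
rewrite (_ : low_const a b * _ * _ = n.+1%:R *
  (A n `^ a * S n `^ b / 16 `^ (`|a| + `|b|)) / 8 ^+ 3 / 8); last first.
  by rewrite /low_const; field; rewrite gt_eqF.
have L8 : 0 < 8 * L by rewrite mulr_gt0.
apply: average3_ge => //.
  by rewrite !mulr_ge0 ?invr_ge0 ?powR_ge0.
rewrite [X in (X%:E <= _)%E](_ : _ = n.+1%:R *
  (A n `^ a * S n `^ b * L ^+ 3 / 16 `^ (`|a| + `|b|))); last first.
  by field; rewrite gt_eqF.
apply: (@integral_ge_sum_disjoint _ _ _ (lebesgue3 R)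
  (fun k => low_box (c k) (l k) (2 ^+ k * t))).
- by move=> k; exact: measurable_low_box.
- exact: measurable_eball3.
- apply: ltn_trivIset => k j jk; apply/seteqP; split => // y [].
  rewrite /low_box /box3 /= !in_itv /= => -[[_ h1] _] [[_ h2] _].
  have : 2 * (2 ^+ j * t) <= 2 ^+ k * t.
    rewrite mulrA -exprS ler_wpM2r ?(ltW t0)// ler_eXn2l ?ltr1n//.
  lra.
- by move=> k; rewrite ltnS; exact: sub.
- by apply/measurable_EFinP; exact: measurable_aniso_weight.
- by move=> y; rewrite lee_fin ltW// aniso_weight_gt0.
- move=> k; rewrite ltnS => kn; have [l0 A0 S0] := pos k kn.
  apply: le_trans; last apply: integral_low_box_ge (comp k kn) => //.
    rewrite lee_fin ler_pM2r ?invr_gt0//; exact: big.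
  by rewrite mulr_gt0// exprn_gt0.
Qed.

(** The case n = 0 of the dyadic estimate: the bulk bound, applied to the dual weight. *)
Lemma average3_one_box a b L c l A S (t : R) :
  0 < L -> 0 < t -> 0 < l -> 0 < A -> 0 < S ->
  comparable_on (low_box c l t) A S ->
  low_box c l t `<=` eball3 0 (8 * L) ->
  L ^+ 3 <= l * t ^+ 2 ->
  ((low_const a b * (A `^ a * S `^ b))%:E <=
     average3 (eball3 (0 : R3 R)%R (8 * L)) (fun y => (aniso_weight a b y)%:E))%E.
Proof.
move=> L0 t0 l0 A0 S0 comp sub big.
have := @average3_dyadic_boxes a b 0 L (fun=> c) (fun=> l) (fun=> A)
  (fun=> S) t L0 t0.
rewrite mulr1; apply => // k; rewrite leqn0 => /eqP k0; rewrite ?k0 ?expr0 ?mul1r//.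
by rewrite ler_wpM2l// mulr_ge0 ?powR_ge0.
Qed.

(** On this box y_1 <= 0, so [wake] is at least 1 + |y| and both factors are of size T. *)
Lemma low_box_center T y : 1 <= T -> low_box (- T) T T y ->
  [/\ 1 + enorm3 y <= 4 * T, T <= enorm3 y, T <= wake y & wake y <= 5 * T].
Proof.
rewrite /low_box /box3 /= !in_itv /= => T1 [[/andP[h1 h2] /andP[h3 h4]] /andP[h5 h6]].
have e1 : enorm3 y <= 3 * T.
  apply: enorm3_le; first lra.
  have : y.1.1 ^+ 2 <= T ^+ 2 by rewrite -sqrrN; apply: lerXn2r; rewrite ?nnegrE; lra.
  have : y.1.2 ^+ 2 <= (2 * T) ^+ 2 by apply: lerXn2r; rewrite ?nnegrE; lra.
  have : y.2 ^+ 2 <= T ^+ 2 by apply: lerXn2r; rewrite ?nnegrE; lra.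
  by have := sqr_ge0 T; rewrite !exprMn; lra.
have e2 : T <= enorm3 y.
  have [_ + _] := coord_le_enorm3 y; have := ler_norm y.1.2; lra.
by rewrite /wake; split; lra.
Qed.

(** At distance about H^2 along the axis and T H across it, [wakeM] makes [wake] of size (T H)^2 /
    H^2 = T^2. *)
Lemma low_box_axis H T y : 1 <= T -> T <= H ->
  low_box (H ^+ 2) (H ^+ 2) (T * H) y ->
  [/\ 1 + enorm3 y <= 4 * H ^+ 2, H ^+ 2 <= enorm3 y,
      T ^+ 2 <= 6 * wake y & wake y <= 12 * T ^+ 2].
Proof.
rewrite /low_box /box3 /= !in_itv /= => T1 TH.
move=> [[/andP[h1 h2] /andP[h3 h4]] /andP[h5 h6]].
have TH0 : 0 < T * H by rewrite mulr_gt0; lra.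
have H21 : 1 <= H ^+ 2 by rewrite exprn_ege1; lra.
have T21 : 1 <= T ^+ 2 by rewrite exprn_ege1; lra.
have s1 : y.1.1 ^+ 2 <= (2 * H ^+ 2) ^+ 2 by apply: lerXn2r; rewrite ?nnegrE; lra.
have s2 : y.1.2 ^+ 2 <= (2 * (T * H)) ^+ 2 by apply: lerXn2r; rewrite ?nnegrE; lra.
have s3 : y.2 ^+ 2 <= (T * H) ^+ 2 by apply: lerXn2r; rewrite ?nnegrE; lra.
have s4 : (T * H) ^+ 2 <= y.1.2 ^+ 2 by apply: lerXn2r; rewrite ?nnegrE; lra.
have s5 : (T * H) ^+ 2 <= (H ^+ 2) ^+ 2.
  have THH : T * H <= H ^+ 2 by rewrite expr2 ler_wpM2r//; lra.
  by apply: lerXn2r; rewrite ?nnegrE; lra.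
have e1 : enorm3 y <= 3 * H ^+ 2.
  apply: enorm3_le; first lra.
  by move: s1 s2 s3 s5; rewrite !(exprMn 2 2) !(exprMn 2 3); lra.
have e2 : H ^+ 2 <= enorm3 y.
  have [+ _ _] := coord_le_enorm3 y; have := ler_norm y.1.1; lra.
have wM := wakeM y; have w1 := wake_ge1 y; have := sqr_ge0 y.2.
have w6 : wake y * (1 + enorm3 y + y.1.1) <= wake y * (6 * H ^+ 2).
  by apply: ler_wpM2l; lra.
have wl : wake y * H ^+ 2 <= wake y * (1 + enorm3 y + y.1.1).
  by apply: ler_wpM2l; lra.
have HT : H ^+ 2 <= T ^+ 2 * H ^+ 2 by rewrite ler_peMl//; lra.
move=> y20; move: s2 s3 s4; rewrite !exprMn => s2 s3 s4.
split; [lra|lra| |].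
- by rewrite -(@ler_pM2r _ (H ^+ 2)); lra.
- by rewrite -(@ler_pM2r _ (H ^+ 2)); lra.
Qed.

Lemma expr2_le (k n : nat) : (k <= n)%N -> 1 <= (2 ^+ k : R) <= 2 ^+ n.
Proof. by move=> kn; rewrite exprn_ege1 ?ler1n//= ler_eXn2l ?ltr1n. Qed.

(** If b <= -1 the boxes lie at distance H^2 along the axis, with widths 2^k H; otherwise they have
    scale 2^k near the origin. The last one, k = n, fills a fixed fraction of the ball and supplies
    [A], [S] for both weights. *)
Lemma average3_blowup a b a' b' (n : nat) : b <= -1 \/ a + b <= -3 ->
  exists r A S : R, [/\ 0 < r, 0 < A, 0 < S,
   ((low_const a b * n.+1%:R * (A `^ a * S `^ b))%:E <=
     average3 (eball3 (0 : R3 R)%R r) (fun y => (aniso_weight a b y)%:E))%E &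
   ((low_const a' b' * (A `^ a' * S `^ b'))%:E <=
     average3 (eball3 (0 : R3 R)%R r) (fun y => (aniso_weight a' b' y)%:E))%E].
Proof.
have P1 k : (k <= n)%N -> 1 <= 2 ^+ k :> R by move=> /expr2_le/andP[].
have P2 k : (k <= n)%N -> 2 ^+ k <= 2 ^+ n :> R by move=> /expr2_le/andP[].
set H : R := 2 ^+ n; have H1 : 1 <= H by exact: P1.
have H21 : 1 <= H ^+ 2 by rewrite exprn_ege1.
have H0 : 0 < H by lra.
have H20 : 0 < H ^+ 2 by lra.
move=> ab; have [b1|b1] := leP b (-1).
  have comp k : (k <= n)%N ->
      comparable_on (low_box (H ^+ 2) (H ^+ 2) (2 ^+ k * H)) (H ^+ 2) ((2 ^+ k) ^+ 2).
    by move=> kn y /(low_box_axis H (2 ^+ k) y (P1 _ kn) (P2 _ kn))[]; split; lra.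
  have sub k : (k <= n)%N ->
      low_box (H ^+ 2) (H ^+ 2) (2 ^+ k * H) `<=` eball3 0 (8 * H ^+ 2).
    move=> kn y /(low_box_axis H (2 ^+ k) y (P1 _ kn) (P2 _ kn))[? ? ? ?].
    by rewrite /eball3 /= subr0; lra.
  exists (8 * H ^+ 2), (H ^+ 2), (H ^+ 2); split => //.
  - lra.
  - apply: (@average3_dyadic_boxes a b n (H ^+ 2) (fun=> H ^+ 2)
      (fun=> H ^+ 2) (fun=> H ^+ 2) (fun k => (2 ^+ k) ^+ 2) H) => //.
    move=> k kn; rewrite -/H -!mulrA ler_pM2l ?powR_gt0//.
    have T21 : 1 <= (2 ^+ k) ^+ 2 :> R by rewrite exprn_ege1// P1.
    have T0 : 0 < (2 ^+ k) ^+ 2 :> R by lra.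
    (* With S = 4^k the cross-section has area S H^2, which raises the exponent of S to b + 1 <= 0:
       the last box carries the least mass. *)
    rewrite [leRHS](_ : _ = ((2 ^+ k) ^+ 2) `^ (b + 1) * (H ^+ 2) ^+ 2).
      rewrite [leLHS](_ : _ = (H ^+ 2) `^ (b + 1) * (H ^+ 2) ^+ 2).
        rewrite ler_pM2r ?exprn_gt0//; apply: powR_le_nonpos => //; last lra.
        by apply: lerXn2r; rewrite ?nnegrE ?exprn_ge0 ?P2// ltW.
      by rewrite powRDn// powRr1 ?(ltW H20)//; ring.
    by rewrite powRDn// powRr1 ?(ltW T0)//; ring.
  - apply: (@average3_one_box a' b' (H ^+ 2) (H ^+ 2) (H ^+ 2) (H ^+ 2) (H ^+ 2)
      (H * H)) => //.
    + exact: comp.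
    + exact: sub.
have {b1}ab : a + b <= -3 by case: ab; lra.
have comp k : (k <= n)%N ->
    comparable_on (low_box (- 2 ^+ k) (2 ^+ k) (2 ^+ k * 1)) (2 ^+ k) (2 ^+ k).
  move=> kn y; rewrite mulr1 => /(low_box_center _ y (P1 _ kn))[].
  by have := P1 _ kn; split; lra.
have sub k : (k <= n)%N ->
    low_box (- 2 ^+ k) (2 ^+ k) (2 ^+ k * 1) `<=` eball3 0 (8 * H).
  move=> kn y; rewrite mulr1 => /(low_box_center _ y (P1 _ kn))[? ? ? ?].
  by rewrite /eball3 /= subr0; have := P2 _ kn; rewrite -/H; lra.
exists (8 * H), H, H; split => //.
- lra.
- apply: (@average3_dyadic_boxes a b n H (fun k => - 2 ^+ k)
      (fun k => 2 ^+ k) (fun k => 2 ^+ k) (fun k => 2 ^+ k) 1) => //.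
  (* A box of scale T carries about T^(a + b + 3), which does not increase with T. *)
  move=> k kn; rewrite -/H mulr1 -!powRDn// ?exprn_gt0//.
  have e (T : R) : 0 < T -> T `^ (a + b) * T ^+ 3 = T `^ (a + b + 3).
    by move=> T0; rewrite -(powR_mulrn 3) ?(ltW T0)// -powRDn.
  rewrite -exprS !e ?exprn_gt0//; apply: powR_le_nonpos; rewrite ?exprn_gt0 ?P2//.
  lra.
- apply: (@average3_one_box a' b' H (- H) H H H (H * 1)) => //.
  + by rewrite mulr1.
  + exact: comp.
  + exact: sub.
  + by rewrite mulr1 -exprS.
Qed.

End lower_bound.

(** * From unbounded averages to the exponents *)

Section necessity.
Context {R : realType}.
Implicit Types (a b p q c C : R).

Lemma exceeds_archimedean c C p : 0 < c -> 0 < p ->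
  exists n : nat, C < c * n.+1%:R `^ p.
Proof.
move=> c0 p0; exists (Num.truncn ((`|C| / c) `^ p^-1)).
apply: le_lt_trans (ler_norm C) _.
rewrite mulrC -ltr_pdivrMr//.
have C0 : 0 <= `|C| / c by rewrite divr_ge0// ltW.
rewrite [ltLHS](_ : _ = ((`|C| / c) `^ p^-1) `^ p).
  by apply: gt0_ltr_powR; rewrite ?nnegrE ?powR_ge0//; exact: truncnS_gt.
by rewrite -powRrM mulVf ?gt_eqF// powRr1.
Qed.

(** If either pair of exponents violates its condition, [average3_blowup] puts a factor n + 1 into
    the corresponding average while the bulk values cancel, so no [C] survives for all n. *)
Lemma muckenhoupt_aniso_weight_gt q a b : 1 < q ->
  muckenhoupt q (@aniso_weight R a b) ->
  (-1 < b /\ -3 < a + b) /\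
  (-1 < - (b / (q - 1)) /\ -3 < - (a / (q - 1)) + - (b / (q - 1))).
Proof.
move=> q1 [_ _ [C C0 h]].
set p := q - 1 in h *; have p0 : 0 < p by rewrite /p; lra.
have {}h r (X Y : R) : 0 < r -> 0 < X -> 0 < Y ->
  (X%:E <= average3 (eball3 (0 : R3 R)%R r) (fun y => (aniso_weight a b y)%:E))%E ->
  (Y%:E <= average3 (eball3 (0 : R3 R)%R r)
     (fun y => (aniso_weight (- (a / p)) (- (b / p)) y)%:E))%E -> X * Y `^ p <= C.
  move=> r0 X0 Y0 hX hY; have := h 0 r r0.
  have -> : (fun y => negpow (aniso_weight a b y) p^-1) =
    (fun y => (aniso_weight (- (a / p)) (- (b / p)) y)%:E).
    by apply/funext => y; rewrite negpow_aniso_weight.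
  rewrite -lee_fin EFinM -poweR_EFin; apply: le_trans; apply: lee_pmul; [|exact: poweR_ge0|exact: hX|].
  - by rewrite lee_fin ltW.
  - apply: gt0_ler_poweR => //; rewrite ?in_itv/= ?andbT ?leey ?lee_fin ?(ltW Y0) ?(ltW p0)//.
    by rewrite andbT average3_aniso_weight_ge0.
(* The bulk values of the weight and of its dual cancel exactly. *)
have dual (A S : R) : 0 < A -> 0 < S ->
    (A `^ a * S `^ b) * (A `^ (- (a / p)) * S `^ (- (b / p))) `^ p = 1.
  move=> A0 S0; rewrite powRM ?powR_ge0// -!powRrM !mulNr !divfK ?gt_eqF// !powRN.
  by field; rewrite !gt_eqF ?powR_gt0.
set a' := - (a / p); set b' := - (b / p).
have c0 := low_const_gt0 a b; have c0' := low_const_gt0 a' b'.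
set cc := low_const a b * low_const a' b' `^ p.
have cc0 : 0 < cc by rewrite mulr_gt0// powR_gt0.
split; apply/andP; rewrite -[_ && _]negbK negb_and -!leNgt; apply/negP => /orP hab.
- have [n] := exceeds_archimedean cc C 1 cc0 ltr01.
  apply/negP; rewrite -leNgt powRr1//.
  have [r [A [S [r0 A0 S0 h1 h2]]]] := average3_blowup a b a' b' n hab.
  apply: le_trans (h _ _ _ r0 _ _ h1 h2); rewrite ?mulr_gt0 ?powR_gt0//.
  rewrite powRM ?mulr_ge0 ?powR_ge0 ?(ltW c0')//.
  rewrite le_eqVlt; apply/orP; left; apply/eqP.
  rewrite -[LHS]mulr1 -(dual A S A0 S0) /cc -/a' -/b'.
  move: (_ `^ p) (_ `^ p) (_ `^ a) (_ `^ b) (low_const a b) => *; ring.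
(* The roles of the two weights are exchanged; the dual average enters with power p, so the gain is
   (n + 1)^p. *)
- have [n] := exceeds_archimedean cc C p cc0 p0.
  apply/negP; rewrite -leNgt.
  have [r [A [S [r0 A0 S0 h1 h2]]]] := average3_blowup a' b' a b n hab.
  apply: le_trans (h _ _ _ r0 _ _ h2 h1); rewrite ?mulr_gt0 ?powR_gt0//.
  have n0 : 0 <= n.+1%:R :> R by [].
  have M0 : 0 <= A `^ a' * S `^ b' by rewrite mulr_ge0 ?powR_ge0.
  have cn0 : 0 <= low_const a' b' * n.+1%:R by rewrite mulr_ge0// ltW.
  rewrite (powRM _ cn0 M0) (powRM _ (ltW c0') n0).
  rewrite le_eqVlt; apply/orP; left; apply/eqP.
  rewrite -[LHS]mulr1 -(dual A S A0 S0) /cc -/a' -/b'.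
  move: (n.+1%:R `^ p) (low_const a' b' `^ p) ((_ * _) `^ p) (A `^ a) (S `^ b)
    (low_const a b) => *; ring.
Qed.

End necessity.

Theorem theorem2p3 (R : realType) (q alpha beta : R) (q_gt1 : 1 < q) :
  muckenhoupt q (aniso_weight alpha beta) <->
  -1 < beta < q - 1 /\ -3 < alpha + beta < 3 * (q - 1).
Proof.
have p0 : 0 < q - 1 by lra.
split=> [/(muckenhoupt_aniso_weight_gt q alpha beta q_gt1)|[]]; last first.
  exact: muckenhoupt_aniso_weight.
(* Multiplying the two dual inequalities by -(q - 1) yields the upper bounds. *)
move=> [[-> ->]] /=; rewrite -opprD -mulrDl ltrNr opprK ltr_pdivrMr//.
by rewrite ltrNr opprK ltr_pdivrMr// mul1r.
Qed.
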